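(* Suppose there exist a parameter value $\bar\theta\in\operatorname{int}\Theta$, a neighbourhood $M$ of $\bar\theta$, and a (possibly random) $\mathbb{R}^p$-valued function $G$ on $M$ such that: (i) $G_n(\bar\theta)\to 0$ in $\mathbb{P}$-probability as $n\to\infty$, and $G(\bar\theta)=0$; (ii) for $\mathbb{P}$-almost all $\omega$, $G(\cdot,\omega)$ and all $G_n(\cdot,\omega)$ are continuously differentiable on $M$, and $\sup_{\theta\in M}\|\partial_\theta G_n(\theta)-\partial_\theta G(\theta)\|\to 0$ in $\mathbb{P}$-probability; (iii) the matrix $\partial_\theta G(\bar\theta)$ is non-singular with $\mathbb{P}$-probability one. Suppose also that there exist a sequence of invertible $p\times p$ matrices $A_n$ with each entry of $A_n^{-1}$ tending to zero, a $p$-dimensional random vector $Z$ defined on an extension of $(\Omega,\mathcal{F},\mathbb{P})$, and a random function $W$ with values in the $p\times p$ matrices, with $W(\bar\theta)$ almost surely invertible, such that for a neighbourhood $M'$ of $\bar\theta$ $$A_nG_n(\bar\theta)\ \xrightarrow{\ \mathcal{L}_{\rm st}\ }\ Z,\qquad \sup_{\theta\in M'}\big\|A_n\,\partial_\theta G_n(\theta)\,A_n^{-1}-W(\theta)\big\|\ \xrightarrow{\ \mathbb{P}\ }\ 0 .$$ Let $(\hat\theta_n)$ be a weakly $\bar\theta$-consistent sequence of $G_n$-estimators. Then $$A_n(\hat\theta_n-\bar\theta)\ \xrightarrow{\ \mathcal{L}_{\rm st}\ }\ -W(\bar\theta)^{-1}Z \qquad\text{and}\qquad A_n\,\partial_\theta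 G_n(\hat\theta_n)\,(\hat\theta_n-\bar\theta)\ \xrightarrow{\ \mathcal{L}_{\rm st}\ }\ -Z .$$
   Context: Setting: $(\Omega,\mathcal{F},\mathbb{P})$ is a complete probability space ($\mathbb{P}$ is the true measure), $\Theta\subseteq\mathbb{R}^p$ is the parameter set, and for each $n$, $\mathcal{F}_n\subseteq\mathcal{F}$ is a $\mathbb{P}$-complete sub-$\sigma$-field (generated by the observations at stage $n$). An estimating function at stage $n$ is a map $G_n:\Theta\times\Omega\to\mathbb{R}^p$ that is measurable with respect to the product of the Borel $\sigma$-field of $\Theta$ with $\mathcal{F}_n$; the argument $\omega$ is usually suppressed. $G_n$-estimators: let $\delta$ be an extra point outside $\Theta$ and $\Theta_\delta=\Theta\cup\{\delta\}$. Let $D_n$ be the set of all $\omega$ for which $G_n(\theta,\omega)=0$ for at least one $\theta\in\Theta$. A $G_n$-estimator is any $\mathcal{F}_n$-measurable map $\hat\theta_n:\Omega\to\Theta_\delta$ such that $\hat\theta_n\in\Theta$ and $G_n(\hat\theta_n)=0$ on $D_n$, and $\hat\theta_n=\delta$ on the complement of $D_n$. The metric on $\Theta_\delta$ is the Euclidean metric on $\Theta$, and the distance between $\delta$ and any point of $\Theta$ is $1$. A sequence $(\hat\theta_n)$ is weakly $\bar\theta$-consistent if $\hat\theta_n\to\bar\theta$ in $\mathbb{P}$-probability as $n\to\infty$; in particular the event where $\hat\theta_n=\delta$ or $\hat\theta_n\notin M$ has probability tending to $0$, and the quantities in the conclusion may be given arbitrary (measurable) values on that event. Extension: a triple $(\bar\Omega,\bar{\mathcal{F}},\bar{\mathbb{P}})$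 with $\bar\Omega=\Omega\times\Omega'$, $\bar{\mathcal{F}}=\mathcal{F}\otimes\mathcal{F}'$ for another measurable space $(\Omega',\mathcal{F}')$, and $\bar{\mathbb{P}}$ a probability measure with $\bar{\mathbb{P}}(A\times\Omega')=\mathbb{P}(A)$ for all $A\in\mathcal{F}$; variables on $\Omega$ are extended trivially to $\bar\Omega$. Stable convergence in law: for $p$-dimensional variables $Z_n$ on $\Omega$ and $Z$ on an extension, $Z_n\xrightarrow{\mathcal{L}_{\rm st}}Z$ means $\mathbb{E}(Yh(Z_n))\to\bar{\mathbb{E}}(Yh(Z))$ for every bounded random variable $Y$ on $(\Omega,\mathcal{F})$ and every bounded continuous $h:\mathbb{R}^p\to\mathbb{R}$. $\|\cdot\|$ is the operator norm on $p\times p$ matrices, and $\partial_\theta G$ the $p\times p$ Jacobian matrix. *)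

(* Defs.v *)
(* R^p is 'cV[R]_p, so matrices act on the left. *)
From HB Require Import structures.
From mathcomp Require Export all_boot all_order all_algebra.
From mathcomp Require Export all_classical all_reals all_analysis.
Export Order.TTheory GRing.Theory Num.Theory.
Export numFieldNormedType.Exports.

Set Implicit Arguments.
Unset Strict Implicit.
Unset Printing Implicit Defensive.

Local Open Scope classical_set_scope.
Local Open Scope ring_scope.

(* The library norm on matrices is the sup norm; it induces the same topology
   as the Euclidean norm defined here. *)
Definition enorm (R : realType) (p : nat) (v : 'cV[R]_p) : R :=
  Num.sqrt (\sum_(i < p) v i ord0 ^+ 2).

(* The real supremum is that of a nonempty bounded set. *)
Definition opnorm (R : realType) (p : nat) (A : 'M[R]_p) : R :=
  sup [set enorm (A *m v) | v in [set v : 'cV[R]_p | enorm v <= 1]].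

(* Entry (i, j) is the j-th partial derivative of the i-th component.  (The
   library's jacobian is for row vectors, with the transposed convention.) *)
Definition Jac (R : realType) (p : nat) (f : 'cV[R]_p -> 'cV[R]_p)
    (x : 'cV[R]_p) : 'M[R]_p :=
  \matrix_(i, j) ('D_(delta_mx j ord0) f x) i ord0.

Definition C1_on (R : realType) (p : nat) (M : set 'cV[R]_p)
    (f : 'cV[R]_p -> 'cV[R]_p) : Prop :=
  (forall x, M x -> differentiable f x) /\ {within M, continuous (Jac f)}.

Definition borel_on (T : topologicalType) (D : set T) : set (set T) :=
  <<s D, [set D `&` U | U in @open T] >>.

Definition prod_sigma (T1 T2 : Type) (D1 : set T1) (D2 : set T2)
    (S1 : set (set T1)) (S2 : set (set T2)) : set (set (T1 * T2)) :=
  <<s D1 `*` D2, [set A `*` B | A in S1 & B in S2] >>.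

(* Measurability of the restriction of f to D, where S is a sigma-field of
   subsets of D and the codomain carries its Borel sigma-field.  Unlike the
   library's measurable_fun, this is not vacuous when D is not measurable. *)
Definition measurable_wrt (T : Type) (V : topologicalType) (D : set T)
    (S : set (set T)) (f : T -> V) : Prop :=
  forall B : set V, borel_on setT B -> S (D `&` f @^-1` B).

Definition random_element d (Omega : measurableType d) (V : topologicalType)
    (f : Omega -> V) : Prop :=
  measurable_wrt setT (@measurable d Omega) f.

(* P-complete sub-sigma-field: the restriction of P to F is complete. *)
Definition complete_sub_sigma_field d (Omega : measurableType d)
    (R : realType) (P : probability Omega R) (F : set (set Omega)) : Prop :=
  [/\ sigma_algebra setT F,
      F `<=` @measurable d Omega &
      forall A N : set Omega, F A -> P A = 0%E -> N `<=` A -> F N].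

(* Only the values of G on Theta `*` setT matter. *)
Definition estimating_function (R : realType) (p : nat) (Omega : Type)
    (Theta : set 'cV[R]_p) (F : set (set Omega))
    (G : 'cV[R]_p -> Omega -> 'cV[R]_p) : Prop :=
  measurable_wrt (Theta `*` setT)
    (prod_sigma Theta setT (borel_on Theta) F) (fun z => G z.1 z.2).

(* The extra point delta is None. *)
Definition Theta_delta (R : realType) (p : nat) (Theta : set 'cV[R]_p) :
    set (option 'cV[R]_p) :=
  None |` (Some @` Theta).

Definition dist_delta (R : realType) (p : nat) (x y : option 'cV[R]_p) : R :=
  match x, y with
  | Some a, Some b => enorm (a - b)
  | None, None => 0
  | _, _ => 1
  end.

Definition open_delta (R : realType) (p : nat) (Theta : set 'cV[R]_p) :
    set (set (option 'cV[R]_p)) :=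
  [set U | U `<=` Theta_delta Theta /\
    forall x, U x -> exists2 e : R, 0 < e &
      forall y, Theta_delta Theta y -> dist_delta x y < e -> U y].

Definition borel_delta (R : realType) (p : nat) (Theta : set 'cV[R]_p) :
    set (set (option 'cV[R]_p)) :=
  <<s Theta_delta Theta, open_delta Theta >>.

Definition has_zero (R : realType) (p : nat) (Omega : Type)
    (Theta : set 'cV[R]_p) (G : 'cV[R]_p -> Omega -> 'cV[R]_p) : set Omega :=
  [set w | exists2 theta, Theta theta & G theta w = 0].

Definition G_estimator (R : realType) (p : nat) (Omega : Type)
    (Theta : set 'cV[R]_p) (F : set (set Omega))
    (G : 'cV[R]_p -> Omega -> 'cV[R]_p)
    (theta_hat : Omega -> option 'cV[R]_p) : Prop :=
  [/\ forall B, borel_delta Theta B -> F (theta_hat @^-1` B),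
      forall w, has_zero Theta G w ->
        exists theta, [/\ theta_hat w = Some theta, Theta theta &
                          G theta w = 0] &
      forall w, ~ has_zero Theta G w -> theta_hat w = None].

(* Convergence to 0 in probability of nonnegative extended-real functions.
   (P^* )%mu is the outer measure of P: it coincides with P on measurable sets,
   and makes sense of the suprema over uncountable parameter sets. *)
Definition cvg_prob0 d (Omega : measurableType d) (R : realType)
    (P : probability Omega R) (X : nat -> Omega -> \bar R) : Prop :=
  forall e : R, 0 < e ->
    ((P^*)%mu [set w | (e%:E < X n w)%E]) @[n --> \oo] --> 0%E.

(* Extended-real supremum: the real one is 0 on unbounded sets. *)
Definition sup_opnorm (R : realType) (p : nat) (M : set 'cV[R]_p)
    (H : 'cV[R]_p -> 'M[R]_p) : \bar R :=
  ereal_sup [set (opnorm (H theta))%:E | theta in M].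

Definition weakly_consistent d (Omega : measurableType d) (R : realType)
    (P : probability Omega R) (p : nat) (thetabar : 'cV[R]_p)
    (theta_hat : nat -> Omega -> option 'cV[R]_p) : Prop :=
  cvg_prob0 P (fun n w => (dist_delta (theta_hat n w) (Some thetabar))%:E).

(* The sigma-field on Omega * Omega' is the product one. *)
Definition is_extension d d' (Omega : measurableType d)
    (Omega' : measurableType d') (R : realType) (P : probability Omega R)
    (Pbar : probability (Omega * Omega')%type R) : Prop :=
  forall A : set Omega, measurable A -> Pbar (A `*` setT) = P A.

Definition stable_cvg d d' (Omega : measurableType d)
    (Omega' : measurableType d') (R : realType) (P : probability Omega R)
    (Pbar : probability (Omega * Omega')%type R) (p : nat)
    (Zn : nat -> Omega -> 'cV[R]_p) (Z : Omega * Omega' -> 'cV[R]_p) : Prop :=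
  forall (Y : Omega -> R) (h : 'cV[R]_p -> R),
    measurable_fun setT Y -> (exists K : R, forall w, `|Y w| <= K) ->
    continuous h -> (exists K : R, forall x, `|h x| <= K) ->
    ('E_P[(fun w => Y w * h (Zn n w))%R])%E @[n --> \oo] -->
      ('E_Pbar[(fun z => Y z.1 * h (Z z))%R])%E.

(* Main.v *)
(* One-step Newton expansion.  Put U_n = A_n G_n(thetabar) and
   W_n(theta) = A_n dG_n(theta) A_n^-1.  As G_n vanishes at the estimator, the
   mean value theorem gives U_n + W(thetabar) X_n = o(1) |X_n| with
   X_n = A_n (thetahat_n - thetabar), because W_n is uniformly close to W, and W
   is almost surely continuous at thetabar as a uniform limit of continuous
   functions.  Stable convergence makes U_n tight, so X_n is tight as well,
   X_n + W(thetabar)^-1 U_n -> 0 and W_n(thetahat_n) X_n + U_n -> 0 in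
   probability.  It remains to see that T U_n -> T Z stably for a random matrix
   T on Omega: approximating T by countably many constant matrices t_j on a
   partition (D_j) of Omega, the indicators of the D_j are absorbed into the
   bounded variable Y of the definition of stable convergence. *)
Require Import Defs.
From mathcomp Require Import ring lra.
From mathcomp Require Import measurable_realfun.

Set Implicit Arguments.
Unset Strict Implicit.
Unset Printing Implicit Defensive.

Local Open Scope classical_set_scope.
Local Open Scope ring_scope.

(** * Norms of matrices *)

Lemma mx_norm_le (R : realType) m n (x : 'M[R]_(m, n)) e :
  0 <= e -> (forall i j, `|x i j| <= e) -> `|x| <= e.
Proof.
move=> e0 xe; rewrite [leLHS]/Num.Def.normr/= mx_normrE.
by apply/bigmax_leP; split => // -[i j] _; exact: xe.
Qed.

Lemma mx_entry_le (R : realType) m n (x : 'M[R]_(m, n)) i j :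
  `|x i j| <= `|x|.
Proof.
rewrite [leRHS]/Num.Def.normr/= mx_normrE.
exact: (le_bigmax _ (fun ij => `|x ij.1 ij.2|) (i, j)).
Qed.

Lemma mulmx_norm (R : realType) m n k (A : 'M[R]_(m, n)) (B : 'M[R]_(n, k)) :
  `|A *m B| <= n%:R * `|A| * `|B|.
Proof.
apply: mx_norm_le => [|i j]; first by rewrite !mulr_ge0.
rewrite mxE (le_trans (ler_norm_sum _ _ _))//.
have -> : n%:R * `|A| * `|B| = \sum_(l < n) `|A| * `|B|.
  by rewrite sumr_const card_ord -mulrA mulr_natl.
by apply: ler_sum => l _; rewrite normrM ler_pM// mx_entry_le.
Qed.

Lemma entry_le_enorm (R : realType) p (v : 'cV[R]_p) i : `|v i ord0| <= enorm v.
Proof.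
rewrite -sqrtr_sqr ler_sqrt; last by apply: sumr_ge0 => j _; exact: sqr_ge0.
by rewrite (bigD1 i)//= lerDl sumr_ge0// => j _; exact: sqr_ge0.
Qed.

Lemma norm_le_enorm (R : realType) p (v : 'cV[R]_p) : `|v| <= enorm v.
Proof.
apply: mx_norm_le => [|i j]; first exact: sqrtr_ge0.
by rewrite (ord1 j) entry_le_enorm.
Qed.

Lemma enorm_le (R : realType) p (v : 'cV[R]_p) e :
  0 <= e -> `|v| <= e -> enorm v <= Num.sqrt p%:R * e.
Proof.
move=> e0 ve; rewrite -[in leRHS](ger0_norm e0) -sqrtr_sqr -sqrtrM// /enorm.
rewrite ler_sqrt; last by rewrite mulr_ge0// sqr_ge0.
rewrite mulr_natl -[X in _ *+ X]card_ord -sumr_const.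
apply: ler_sum => i _; rewrite -(real_normK (num_real (v i ord0))).
by rewrite lerXn2r// ?nnegrE// (le_trans (mx_entry_le v i ord0)).
Qed.

Lemma enorm_mulmx_le_opnorm (R : realType) p (A : 'M[R]_p) v :
  enorm v <= 1 -> enorm (A *m v) <= opnorm A.
Proof.
move=> v1; apply: ub_le_sup; last by exists v.
exists (Num.sqrt p%:R * (p%:R * `|A| * 1)) => _ [u u1 <-].
apply: enorm_le; first by rewrite !mulr_ge0.
rewrite (le_trans (mulmx_norm _ _))// ler_wpM2l ?mulr_ge0//.
exact: le_trans (norm_le_enorm _) u1.
Qed.

(** Each entry of [A] is a coordinate of the image of a standard basis vector, whose Euclidean norm
    is 1. This turns operator-norm hypotheses into sup-norm bounds, in which all later estimates are
    made. *)
Lemma norm_le_opnorm (R : realType) p (A : 'M[R]_p) : `|A| <= opnorm A.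
Proof.
have enorm_delta (j : 'I_p) : enorm (delta_mx j ord0 : 'cV[R]_p) <= 1.
  rewrite /enorm (bigD1 j)//= big1 => [|i ij]; last first.
    by rewrite mxE (negPf ij)/= expr0n.
  by rewrite mxE !eqxx/= expr1n addr0 sqrtr1.
apply: mx_norm_le => [|i j].
  apply: le_trans (sqrtr_ge0 _) (@enorm_mulmx_le_opnorm _ _ A 0 _).
  by rewrite /enorm big1 ?sqrtr0// => i _; rewrite mxE expr0n.
apply: le_trans (enorm_mulmx_le_opnorm A (enorm_delta j)).
apply: le_trans (entry_le_enorm _ i); rewrite mxE (bigD1 j)//= big1 => [|k kj].
  by rewrite mxE !eqxx/= mulr1 addr0.
by rewrite mxE (negPf kj) mulr0.
Qed.

Lemma mx_rat_dense (R : realType) m n (x : 'M[R]_(m, n)) e :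
  0 < e -> exists q : 'M[rat]_(m, n), `|x - map_mx ratr q| < e.
Proof.
move=> e0; have e20 : 0 < e / 2 by rewrite divr_gt0.
have /choice[f fP] : forall ij : 'I_m * 'I_n, exists q : rat,
    `|x ij.1 ij.2 - ratr q| < e / 2.
  move=> ij; have [|y [yx [q _ qy]]] :=
    @dense_rat R (ball (x ij.1 ij.2) (e / 2)) _ (ball_open _ _).
    by exists (x ij.1 ij.2); exact: ballxx.
  by exists q; rewrite qy.
exists (\matrix_(i, j) f (i, j)); apply: (@le_lt_trans _ _ (e / 2)).
  apply: mx_norm_le => [|i j]; first exact: ltW.
  by rewrite !mxE; exact/ltW/(fP (i, j)).
by rewrite ltr_pdivrMr// ltr_pMr// ltr1n.
Qed.

(** * Random matrices *)

(** The entrywise form reduces sums, products and inverses to real-valued measurability.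
    [random_element_mx_measurable] and [mx_measurable_comp] link it to Borel measurability. *)
Definition mx_measurable d (T : measurableType d) (R : realType) m n
    (X : T -> 'M[R]_(m, n)) : Prop :=
  forall i j, measurable_fun setT (fun w => X w i j).

Section mx_measurable.
Context d (T : measurableType d) (R : realType).

Lemma measurable_set_lt (f g : T -> R) : measurable_fun setT f ->
  measurable_fun setT g -> measurable [set w | f w < g w].
Proof.
move=> mf mg; rewrite -[X in measurable X]setTI.
exact: (measurable_fun_ltr mf mg measurableT (Y := [set true])).
Qed.

Lemma random_element_comp (V : topologicalType) (X : T -> V) (g : V -> R) :
  random_element X -> continuous g -> measurable_fun setT (g \o X).
Proof.
move=> mX /continuousP cg.
apply: (measurability _ (RGenOpens.measurableE R)).
move=> _ [_ [a [b ->] <-]]; rewrite comp_preimage; apply: mX.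
apply: sub_sigma_algebra; exists (g @^-1` `]a, b[%classic).
  exact/cg/interval_open.
by rewrite setTI.
Qed.

Lemma random_element_mx_measurable m n (X : T -> 'M[R]_(m, n)) :
  random_element X -> mx_measurable X.
Proof.
move=> mX i j.
exact: (random_element_comp mX (coord_continuous (i := i) (j := j))).
Qed.

(** An open set is the union of the countably many boxes with rational centre and radius [1/(k+1)]
    that it contains, and a box is a finite intersection of conditions on single entries. *)
Lemma mx_measurable_preimage_open m n (X : T -> 'M[R]_(m, n)) O :
  mx_measurable X -> open O -> measurable (X @^-1` O).
Proof.
move=> mX oO.
pose B (qk : 'M[rat]_(m, n) * nat) : set 'M[R]_(m, n) :=
  [set x | forall i j, `|x i j - ratr (qk.1 i j)| < qk.2.+1%:R^-1].
have -> : X @^-1` O =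
    \bigcup_qk [set w | B qk `<=` O /\ B qk (X w)].
  apply/seteqP; split => [w Ow|w [qk _ [BO Bw]]]; last exact: BO.
  have [e e0 eO] : exists2 e : R, 0 < e & ball (X w) e `<=` O.
    by apply/nbhs_ballP; exact: open_nbhs_nbhs.
  have e20 : 0 < e / 2 by rewrite divr_gt0.
  have [k _ /(_ k (leqnn k))/= ke] := near_infty_natSinv_lt (PosNum e20).
  have [|q qX] := @mx_rat_dense R _ _ (X w) k.+1%:R^-1.
    by rewrite invr_gt0.
  have Bq i j : `|X w i j - ratr (q i j)| < k.+1%:R^-1.
    by apply: le_lt_trans qX; have := mx_entry_le (X w - map_mx ratr q) i j;
      rewrite !mxE.
  exists (q, k) => //; split => // x /= Bx; apply: eO; split => // i j.
  rewrite /ball/= -(subrKA (ratr (q i j))) (le_lt_trans (ler_normD _ _))//.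
  by rewrite [ltRHS]splitr ltrD// ?(lt_trans _ ke)// distrC.
apply: countable_bigcupT_measurable => // -[q k].
have [BO|BO] := pselect (B (q, k) `<=` O); last first.
  by rewrite (_ : mkset _ = set0)//; apply/seteqP; split => // w [].
rewrite (_ : mkset _ = \bigcap_(ij : 'I_m * 'I_n)
  [set w | `|X w ij.1 ij.2 - ratr (q ij.1 ij.2)| < k.+1%:R^-1]); last first.
  by apply/seteqP; split => [w [_ Bw] ij _|w Bw]; [exact: Bw|split => // i j;
    exact: (Bw (i, j))].
apply: fin_bigcap_measurable => [|[i j] _ /=]; first exact: finite_finset.
apply: measurable_set_lt => //.
by apply: measurableT_comp => //; apply: measurable_funB => //; exact: mX.
Qed.

(** The sets with measurable preimage under [X] form a sigma-algebra containing the open sets, hence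
    all Borel sets. *)
Lemma mx_measurable_comp m n (X : T -> 'M[R]_(m, n)) (h : 'M[R]_(m, n) -> R) :
  mx_measurable X -> continuous h -> measurable_fun setT (h \o X).
Proof.
move=> mX ch; apply: (random_element_comp (X := X)) => // B.
rewrite setTI; move: B; apply: smallest_sub; last first.
  by move=> _ [U oU <-] /=; rewrite setTI; exact: mx_measurable_preimage_open.
split => [|A mA|F mF] /=; first by rewrite preimage_set0.
  by rewrite setTD preimage_setC; exact: measurableC.
by rewrite preimage_bigcup; exact: bigcupT_measurable.
Qed.

Lemma mx_measurable_norm m n (X : T -> 'M[R]_(m, n)) :
  mx_measurable X -> measurable_fun setT (fun w => `|X w|).
Proof.
by move=> mX; apply: (mx_measurable_comp mX); exact: norm_continuous.
Qed.

Lemma mx_measurable_cst m n (A : 'M[R]_(m, n)) : mx_measurable (fun _ : T => A).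
Proof. by move=> i j; exact: measurable_cst. Qed.

Lemma mx_measurableD m n (X Y : T -> 'M[R]_(m, n)) :
  mx_measurable X -> mx_measurable Y -> mx_measurable (fun w => X w + Y w).
Proof.
move=> mX mY i j; under eq_fun do rewrite mxE.
by apply: measurable_funD; [exact: mX|exact: mY].
Qed.

Lemma mx_measurableN m n (X : T -> 'M[R]_(m, n)) :
  mx_measurable X -> mx_measurable (fun w => - X w).
Proof.
move=> mX i j; under eq_fun do rewrite mxE.
by apply: measurableT_comp => //; exact: mX.
Qed.

Lemma mx_measurableM m n k (X : T -> 'M[R]_(m, n)) (Y : T -> 'M[R]_(n, k)) :
  mx_measurable X -> mx_measurable Y -> mx_measurable (fun w => X w *m Y w).
Proof.
move=> mX mY i j; under eq_fun do rewrite mxE.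
apply: measurable_sum => l.
by apply: measurable_funM; [exact: mX|exact: mY].
Qed.

Lemma measurable_det n (X : T -> 'M[R]_n) :
  mx_measurable X -> measurable_fun setT (fun w => \det (X w)).
Proof.
move=> mX; apply: measurable_sum => s; apply: measurable_funM => //.
by apply: measurable_prod => i _; exact: mX.
Qed.

Lemma mx_measurable_adj n (X : T -> 'M[R]_n) :
  mx_measurable X -> mx_measurable (fun w => \adj (X w)).
Proof.
move=> mX i j; under eq_fun do rewrite mxE /cofactor.
apply: measurable_funM => //; apply: measurable_det => k l.
by under eq_fun do rewrite !mxE; exact: mX.
Qed.

Lemma measurable_funV (f : T -> R) :
  measurable_fun setT f -> measurable_fun setT (fun w => (f w)^-1).
Proof.
move=> mf.
(* Since the inverse of 0 is 0 by convention, the zero set of [f] is split off; inversion is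
   continuous on the rest. *)
have -> : (fun w => (f w)^-1) =
    (fun w => if f w == 0 then 0 else (GRing.inv \o f) w).
  by apply/funext => w; case: eqP => // ->; rewrite invr0.
apply: measurable_fun_if => //.
  exact: measurable_fun_eqr.
have -> : setT `&` (fun w => f w == 0) @^-1` [set false] =
    setT `&` f @^-1` [set~ 0].
    by congr (_ `&` _); apply/seteqP; split => w /=;
    [move=> /negbT/eqP|move=> /eqP/negPf].
apply: (@measurable_comp _ _ _ _ _ _ [set r : R | r != 0]).
- by apply: open_measurable; exact: open_neq.
- by move=> _ [w [_ /eqP fw] <-].
- apply: open_continuous_measurable_fun; first exact: open_neq.
  by apply/in_setP => x /= x0; exact: inv_continuous.
- exact: measurable_funS mf.
Qed.

(** Cramer's formula, with a case split: [invmx] returns a singular matrix unchanged. *)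
Lemma mx_measurableV n (X : T -> 'M[R]_n) :
  mx_measurable X -> mx_measurable (fun w => invmx (X w)).
Proof.
move=> mX i j; rewrite /invmx.
have -> : (fun w => (if X w \in unitmx then (\det (X w))^-1 *: \adj (X w)
    else X w) i j) =
  (fun w => if \det (X w) == 0 then X w i j
    else (\det (X w))^-1 * \adj (X w) i j).
  by apply/funext => w; rewrite unitmxE unitfE; case: eqP => //=; rewrite mxE.
have mdet := measurable_det mX.
apply: measurable_fun_ifT; [exact: measurable_fun_eqr|exact: mX|].
apply: measurable_funM; first exact: measurable_funV.
exact: mx_measurable_adj.
Qed.

End mx_measurable.

(** Only [x] is confined to a ball; [y] may leave it. The near-covering form of compactness makes
    the local moduli of continuity uniform in [x]. *)
Lemma cV_unif_continuous (R : realType) p (h : 'cV[R]_p -> R) (L e : R) :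
  continuous h -> 0 < e ->
  exists2 g : R, 0 < g &
    forall x y, `|x| <= L -> `|x - y| <= g -> `|h x - h y| <= e.
Proof.
move=> ch e0.
pose K := [set x : 'rV[R]_p | `|x| <= L].
have /compact_near_coveringP cK : compact K.
  apply: bounded_closed_compact.
    exists L; split; first exact: num_real.
    by move=> r Lr x /= /le_trans; apply; exact: ltW.
  rewrite (_ : K = Num.norm @^-1` [set r | r <= L])//.
  by apply: closed_comp; [move=> x _; exact: norm_continuous|exact: closed_le].
have : \forall g \near (0 : R)^'+, K `<=` [set x : 'rV[R]_p |
    forall y : 'cV[R]_p, `|x^T - y| <= g -> `|h x^T - h y| <= e].
  apply: cK => x _.
  have e20 : 0 < e / 2 by rewrite divr_gt0.
  have hx : h y @[y --> x^T] --> h x^T by exact: ch.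
  have hxe : \forall y \near x^T, `|h x^T - h y| < e / 2.
    by move/cvgrPdist_lt : hx; exact.
  have [r /= r0 hr] := iffLR (nbhs_ballP _ _) hxe.
  have r20 : 0 < r / 2 by rewrite divr_gt0.
  (* With [x'] within [r / 2] of [x] and [y] within [r / 2] of [x'], both lie in the ball of radius
     [r] around [x], where [h] moves by less than [e / 2]. *)
  exists (ball x (r / 2), [set g | g < r / 2]) => /=.
    by split; [exact: nbhsx_ballx|exact: nbhs_right_lt].
  move=> [x' g] /= [xx' gr] y x'y.
  have xx'T : ball x^T (r / 2) x'^T.
    by case: xx' => _ xx'; split => // i j; rewrite !mxE; exact: xx'.
  have hx' : `|h x^T - h x'^T| < e / 2.
    by apply: hr; apply: le_ball xx'T; rewrite ler_pdivrMr// ler_pMr// ler1n.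
  have hy : `|h x^T - h y| < e / 2.
    apply: hr; rewrite [r]splitr; apply: ball_triangle xx'T _.
    by rewrite mx_norm_ball /ball_/=; exact: le_lt_trans gr.
  rewrite -(subrKA (h x^T)) (le_trans (ler_normD _ _))// [leRHS]splitr.
  by rewrite lerD ?ltW// distrC.
move=> hK; near (0 : R)^'+ => g.
exists g => // x y xL xy.
have : K x^T.
  rewrite /K/=; apply: le_trans xL; apply: mx_norm_le => // i j.
  by rewrite mxE mx_entry_le.
move: x^T (trmxK x) => x' <- in xy *.
by move/(near hK g _ x'); apply.
Unshelve. all: by end_near. Qed.

(** * Expectations and stable convergence *)

Section probability_bounds.
Context d (T : measurableType d) (R : realType) (P : probability T R).

(** Continuity from above; it produces the small exceptional events for tightness, for countable
    partitions and for oscillations. *)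
Lemma probability_decreasing_small (E : nat -> set T) (e : R) :
  (forall k, measurable (E k)) -> (forall k, E k.+1 `<=` E k) ->
  P (\bigcap_k E k) = 0%E -> 0 < e -> exists k, (P (E k) <= e%:E)%E.
Proof.
move=> mE Edec E0 e0.
have : (P \o E) n @[n --> \oo] --> P (\bigcap_k E k).
  apply: nonincreasing_cvg_mu => //.
  - by rewrite (le_lt_trans (probability_le1 _ _))// ltry.
  - exact: bigcapT_measurable.
  - by apply/nonincreasing_seqP => n; apply/subsetPset; exact: Edec.
rewrite E0 => /fine_cvgP[_ /cvgrPdist_lt/(_ _ e0)[k _ /(_ k (leqnn k))]] /=.
rewrite sub0r normrN => Pk; exists k.
rewrite -(fineK (fin_num_measure P _ (mE k))).
  by rewrite lee_fin; apply/ltW; apply: le_lt_trans Pk; exact: ler_norm.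
Qed.

Lemma norm_tight m n (X : T -> 'M[R]_(m, n)) (e : R) :
  mx_measurable X -> 0 < e ->
  exists2 r : R, 0 < r & (P [set w | r < `|X w|]%R <= e%:E)%E.
Proof.
move=> mX e0; have [k Pk] : exists k : nat,
    (P [set w | k%:R < `|X w|]%R <= e%:E)%E.
  apply: probability_decreasing_small => //.
  - by move=> k; apply: measurable_set_lt => //; exact: mx_measurable_norm.
  - by move=> k w /=; apply: lt_trans; rewrite ltr_nat.
  - rewrite (_ : \bigcap_k _ = set0) ?measure0//; apply/seteqP; split => // w.
    move=> /(_ (Num.trunc `|X w|).+1 I) /=; apply/negP; rewrite -leNgt ltW//.
    exact: truncnS_gt.
(* The successor makes the radius positive even when [k] is 0. *)
exists k.+1%:R => //; apply: le_trans Pk; apply: le_measure; rewrite ?inE.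
- by apply: measurable_set_lt => //; exact: mx_measurable_norm.
- by apply: measurable_set_lt => //; exact: mx_measurable_norm.
- by move=> w /=; apply: lt_trans; rewrite ltr_nat.
Qed.

Lemma bounded_integrable (f : T -> R) K :
  measurable_fun setT f -> (forall w, `|f w| <= K) ->
  P.-integrable setT (EFin \o f).
Proof.
move=> mf fK; apply: measurable_bounded_integrable => //.
  by rewrite (le_lt_trans (probability_le1 _ _))// ltry.
exists K; split; first exact: num_real.
by move=> r Kr w _ /=; apply: le_trans (fK w) (ltW Kr).
Qed.

Lemma expectationE (f : T -> R) K :
  measurable_fun setT f -> (forall w, `|f w| <= K) ->
  ('E_P[f] = (\int[P]_w f w)%:E)%E.
Proof.
move=> mf fK; rewrite expectation.unlock /Rintegral fineK//.
by apply: integrable_fin_num => //; exact: bounded_integrable fK.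
Qed.

Lemma Rintegral_indicT (B : set T) :
  measurable B -> \int[P]_w \1_B w = fine (P B).
Proof. by move=> mB; rewrite /Rintegral integral_indic// setIT. Qed.

Lemma fine_probability_le (B : set T) (e : R) :
  measurable B -> (P B <= e%:E)%E -> fine (P B) <= e.
Proof.
by move=> mB; rewrite -lee_fin fineK// fin_num_measure.
Qed.

(** The difference of the integrands is bounded pointwise by [e + K * \1_B], which is then
    integrated. *)
Lemma Rintegral_dist_le (f g : T -> R) (B : set T) (L e K : R) :
  measurable_fun setT f -> measurable_fun setT g ->
  (forall w, `|f w| <= L) -> (forall w, `|g w| <= L) ->
  measurable B -> 0 <= e -> 0 <= K ->
  (forall w, ~ B w -> `|f w - g w| <= e) ->
  (forall w, `|f w - g w| <= K) ->
  `|\int[P]_w f w - \int[P]_w g w| <= e + K * fine (P B).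
Proof.
move=> mf mg fL gL mB e0 K0 fge fgK.
have intf := bounded_integrable mf fL; have intg := bounded_integrable mg gL.
have mfg : measurable_fun setT (fun w => f w - g w) by exact: measurable_funB.
have intfg := bounded_integrable mfg fgK.
have mKB : measurable_fun setT (fun w => K * \1_B w) by exact: measurable_funM.
have KB w : `|K * \1_B w| <= K.
  rewrite normrM (ger0_norm K0) ler_piMr// indicE.
  by case: (_ \in _); rewrite ?normr1 ?normr0.
have mC : measurable_fun setT (cst e : T -> R) by exact: measurable_cst.
rewrite -RintegralB//.
apply: le_trans (le_normr_Rintegral _ _) _ => //.
have -> : e + K * fine (P B) = \int[P]_w (e + K * \1_B w).
  rewrite RintegralD//; last 2 first.
  - by apply: (bounded_integrable (K := e) mC) => w /=; rewrite ger0_norm.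
  - exact: bounded_integrable KB.
  rewrite RintegralZl//; last first.
    apply: (bounded_integrable (K := 1)) => // w.
    by rewrite indicE; case: (_ \in _); rewrite ?normr1 ?normr0.
  rewrite Rintegral_indicT// /Rintegral integral_cst//= probability_setT.
  by rewrite mule1.
apply: le_Rintegral => //.
- apply: (bounded_integrable (K := K)) => [|w].
    by apply: measurableT_comp.
  by rewrite normr_id.
- apply: (bounded_integrable (K := e + K)) => [|w].
    by apply: measurable_funD.
  by rewrite (le_trans (ler_normD _ _))// ger0_norm// lerD.
move=> w _; rewrite indicE; have [wB|wB] := boolP (w \in B).
  by rewrite mulr1 (le_trans (fgK w))// lerDr.
by rewrite mulr0 addr0; apply: fge => /mem_set; exact/negP.
Qed.

Lemma Rintegral_sum_ord N (f : 'I_N -> T -> R) K :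
  (forall j, measurable_fun setT (f j)) -> (forall j w, `|f j w| <= K) ->
  \int[P]_w (\sum_(j < N) f j w) = \sum_(j < N) \int[P]_w f j w.
Proof.
move=> mf fK; rewrite /Rintegral; under eq_integral do rewrite -sumEFin.
rewrite integral_sum//; last first.
  by move=> j; apply: bounded_integrable (fK j).
rewrite (eq_bigr (fun j => (fine (\int[P]_w (f j w)%:E))%:E)).
  by rewrite sumEFin.
move=> j _; rewrite fineK//; apply: integrable_fin_num => //.
exact: bounded_integrable (fK j).
Qed.

End probability_bounds.

(** * Replacing a random matrix by finitely many constant ones *)

(** Off [B] exactly one term of the sum survives, and it is within [K * e] of the integrand; on [B]
    the crude bound [2 * (K * H)] is used. The map [f] lets one statement serve both [Omega]
    (identity) and the extension (first projection). *)
Lemma Rintegral_simple_approx d (T : measurableType d) (R : realType)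
    d' (S : measurableType d') (Q : probability S R) (f : S -> T) p
    (Y : T -> R) (U X : S -> 'cV[R]_p) (h : 'cV[R]_p -> R)
    (D : nat -> set T) (t : nat -> 'M[R]_p) N (B : set S) (K H e : R) :
  measurable_fun setT f -> measurable_fun setT Y ->
  mx_measurable U -> mx_measurable X -> continuous h ->
  (forall w, `|Y w| <= K) -> (forall x, `|h x| <= H) -> 0 <= e ->
  (forall j, measurable (D j)) -> trivIset setT D -> measurable B ->
  (forall w, ~ B w ->
    exists j, [/\ (j < N)%N, D j (f w) & `|h (X w) - h (t j *m U w)| <= e]) ->
  `|\int[Q]_w (Y (f w) * h (X w)) -
    \sum_(j < N) \int[Q]_w (Y (f w) * \1_(D j) (f w) * h (t j *m U w))|
  <= K * e + 2 * (K * H) * fine (Q B).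
Proof.
move=> mf mY mU mX ch YK hH e0 mD tD mB bad.
have K0 : 0 <= K by exact: le_trans (YK (f point)).
have H0 : 0 <= H by exact: le_trans (hH 0).
pose g (j : 'I_N) w := Y (f w) * \1_(D j) (f w) * h (t j *m U w).
have mYf : measurable_fun setT (Y \o f) by exact: measurableT_comp.
have mg j : measurable_fun setT (g j).
  apply: measurable_funM; first apply: measurable_funM => //.
    have mDj : measurable_fun setT (\1_(D j) : T -> R).
      exact: measurable_indic.
    exact: (measurableT_comp mDj mf).
  have mtU : mx_measurable (fun w => t j *m U w).
    by apply: mx_measurableM => //; exact: mx_measurable_cst.
  exact: mx_measurable_comp mtU ch.
have gK j w : `|g j w| <= K * H.
  rewrite /g !normrM indicE; case: (_ \in _); rewrite ?normr0 ?normr1.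
    by rewrite mulr1 ler_pM.
  by rewrite mulr0 mul0r mulr_ge0.
have gD j w : D j (f w) -> forall jN : (j < N)%N,
    \sum_(i < N) g i w = Y (f w) * h (t j *m U w).
  move=> Djw jN; rewrite (bigD1 (Ordinal jN))//= big1 => [|i ij].
    by rewrite /g/= indicE mem_set// mulr1 addr0.
  rewrite /g indicE memNset ?mulr0 ?mul0r// => Diw.
  move: ij; rewrite -val_eqE/= => /eqP; apply.
  by apply: (tD i j) => //; exists (f w).
(* The bound does not grow with [N], because the [D j] are disjoint and at most one indicator is
   nonzero. *)
have gK' w : `|\sum_(i < N) g i w| <= K * H.
  have [[j [jN Djw]]|nD] := pselect (exists j, (j < N)%N /\ D j (f w)).
    by rewrite (gD j)// normrM ler_pM.
  rewrite big1 ?normr0 ?mulr_ge0// => i _.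
  rewrite /g indicE memNset ?mulr0 ?mul0r// => Diw; apply: nD.
  by exists i; split.
have mh : measurable_fun setT (fun w => Y (f w) * h (X w)).
  by apply: measurable_funM => //; exact: mx_measurable_comp mX ch.
have hK w : `|Y (f w) * h (X w)| <= K * H by rewrite normrM ler_pM.
rewrite -(Rintegral_sum_ord Q mg gK).
apply: (@Rintegral_dist_le _ _ _ _ _ _ _ (K * H)) => //.
- by apply: measurable_sum => i; exact: mg.
- by rewrite mulr_ge0.
- by rewrite !mulr_ge0.
- move=> w /bad[j [jN Djw hj]]; rewrite (gD j)// -mulrBr normrM.
  by rewrite ler_pM.
- move=> w; rewrite (le_trans (ler_normB _ _))// mulr2n mulrDl mul1r.
  by rewrite lerD.
Qed.

(** Balls of radius [r] around the rational matrices cover the space. Made disjoint by [seqDU],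
    their preimages partition it, and finitely many of them carry all but [e] of the mass. *)
Lemma countable_partition_small d (T : measurableType d) (R : realType)
    (P : probability T R) m n (X : T -> 'M[R]_(m, n)) (r e : R) :
  mx_measurable X -> 0 < r -> 0 < e ->
  exists (t : nat -> 'M[R]_(m, n)) (D : nat -> set T) (N : nat) (B : set T),
    [/\ forall j, measurable (D j), trivIset setT D, measurable B,
        (P B <= e%:E)%E &
        forall w, ~ B w -> exists j, [/\ (j < N)%N, D j w & `|X w - t j| < r]].
Proof.
move=> mX r0 e0.
(* A code that decodes to no matrix yields 0; this only repeats a centre and does not affect the
   covering. *)
pose t j : 'M[R]_(m, n) :=
  map_mx ratr (odflt 0 (unpickle j : option 'M[rat]_(m, n))).
pose F j := [set w | `|X w - t j| < r].
have mF j : measurable (F j).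
  apply: measurable_set_lt => //; apply: mx_measurable_norm.
  by apply: mx_measurableD => //; exact: mx_measurable_cst.
have FT : \bigcup_j F j = setT.
  apply/seteqP; split => // w _; have [q qX] := mx_rat_dense (X w) r0.
  by exists (pickle q) => //; rewrite /F /t /= pickleK.
have mD j : measurable (seqDU F j).
  by apply: measurableD => //; exact: bigsetU_measurable.
pose B k := ~` \bigcup_(j in [set j | (j < k)%N]) seqDU F j.
have mB k : measurable (B k).
  by apply: measurableC; exact: bigcup_measurable.
have [N PN] : exists N, (P (B N) <= e%:E)%E.
  apply: probability_decreasing_small => //.
    move=> k w Bw [j /= jk Dj]; apply: Bw; exists j => //=.
    exact: ltn_trans jk _.
  rewrite (_ : \bigcap_k _ = set0) ?measure0//; apply/seteqP; split => // w Bw.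
  have : (\bigcup_j F j) w by rewrite FT.
  rewrite seqDU_bigcup_eq => -[j _ Dj]; apply: (Bw j.+1 I).
  by exists j => //=.
exists t, (seqDU F), N, (B N); split => //.
move=> w /contrapT[j /= jN Dj]; exists j; split => //.
by case: Dj.
Qed.

(** * Tightness from stable convergence, and multiplication of a stable limit by a random matrix *)

Section stable_convergence.
Context d d' (Omega : measurableType d) (Omega' : measurableType d').
Context (R : realType) (P : probability Omega R).
Context (Pbar : probability (Omega * Omega')%type R) (p : nat).
Context (U : nat -> Omega -> 'cV[R]_p) (Z : Omega * Omega' -> 'cV[R]_p).
Hypothesis mU : forall n, mx_measurable (U n).
Hypothesis mZ : mx_measurable Z.
Hypothesis UZ : stable_cvg P Pbar U Z.

Lemma stable_cvg_Rintegral (Y : Omega -> R) (h : 'cV[R]_p -> R) (K H : R) :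
  measurable_fun setT Y -> (forall w, `|Y w| <= K) ->
  continuous h -> (forall x, `|h x| <= H) ->
  \int[P]_w (Y w * h (U n w)) @[n --> \oo] -->
    \int[Pbar]_z (Y z.1 * h (Z z)).
Proof.
move=> mY YK ch hH.
have := UZ mY (ex_intro _ K YK) ch (ex_intro _ H hH).
rewrite (@expectationE _ _ _ _ _ (K * H)); last 2 first.
- apply: measurable_funM; first exact: measurableT_comp mY measurable_fst.
  exact: mx_measurable_comp mZ ch.
- by move=> z; rewrite normrM ler_pM.
have UE n : ('E_P[(fun w => Y w * h (U n w))%R] =
    (\int[P]_w (Y w * h (U n w)))%R%:E)%E.
  apply: (@expectationE _ _ _ _ _ (K * H)) => [|w].
    by apply: measurable_funM => //; exact: mx_measurable_comp (mU n) ch.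
  by rewrite normrM ler_pM.
under eq_fun do rewrite UE.
by move=> /fine_cvgP[].
Qed.

Lemma stable_cvg_tight (e : R) : 0 < e -> exists2 r : R, 0 < r &
  \forall n \near \oo, (P [set w | r < `|U n w|]%R <= e%:E)%E.
Proof.
move=> e0; have e20 : 0 < e / 2 by rewrite divr_gt0.
have [r r0 Pr] := norm_tight Pbar mZ e20.
exists (r + 1); first by rewrite addr_gt0.
(* A continuous ramp, 0 up to norm [r] and 1 from norm [r + 1] on, lying between the indicators of
   norm above [r + 1] and of norm above [r]. It is tested against [Y = 1]. *)
pose h : 'cV[R]_p -> R := cst 1 \min (cst 0 \max (fun x => `|x| - r)).
have ch : continuous h.
  move=> x; apply: continuous_min; first exact: cst_continuous.
  apply: continuous_max; first exact: cst_continuous.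
  by apply: continuousB; [exact: norm_continuous|exact: cst_continuous].
have h0 x : 0 <= h x by rewrite /h le_min ler01 le_max lexx.
have h1 x : `|h x| <= 1 by rewrite ger0_norm// /h ge_min lexx.
have Y1 (w : Omega) : `|cst 1 w : R| <= 1 by rewrite normr1.
have mY1 : measurable_fun setT (cst 1 : Omega -> R) by exact: measurable_cst.
have := stable_cvg_Rintegral mY1 Y1 ch h1.
under eq_fun do under eq_Rintegral do rewrite mul1r.
under eq_Rintegral do rewrite mul1r.
have mh n : measurable_fun setT (fun w => h (U n w)).
  exact: mx_measurable_comp (mU n) ch.
have mhZ : measurable_fun setT (fun w => h (Z w)).
  exact: mx_measurable_comp mZ ch.
have mZr : measurable [set z | r < `|Z z|].
  by apply: measurable_set_lt => //; exact: mx_measurable_norm.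
have indic1 (T : Type) (B : set T) w : `|\1_B w : R| <= 1.
  by rewrite indicE; case: (_ \in _); rewrite ?normr1 ?normr0.
have hZ : \int[Pbar]_z h (Z z) <= e / 2.
  apply: le_trans (fine_probability_le mZr Pr).
  rewrite -Rintegral_indicT//; apply: le_Rintegral => //.
  - exact: bounded_integrable _ mhZ _.
  - by apply: (bounded_integrable _ (K := 1)) => //; exact: measurable_indic.
  move=> z _; rewrite indicE; have [|/negP rZ] := boolP (_ \in _).
    by move=> _; rewrite (le_trans (ler_norm _)).
  rewrite /h; move: rZ; rewrite in_setE/= => /negP; rewrite -leNgt => rZ.
  by rewrite max_l ?subr_le0// min_r.
move=> /cvgrPdist_lt/(_ _ e20); apply: filterS => n hn.
have mUr : measurable [set w | r + 1 < `|U n w|].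
  by apply: measurable_set_lt => //; exact: mx_measurable_norm.
rewrite -(fineK (fin_num_measure P _ mUr)) lee_fin -Rintegral_indicT//.
apply: (@le_trans _ _ (\int[P]_w h (U n w))).
  apply: le_Rintegral => //.
  - by apply: (bounded_integrable _ (K := 1)) => //; exact: measurable_indic.
  - exact: bounded_integrable _ (mh n) _.
  move=> w _; rewrite indicE; have [|//] := boolP (_ \in _).
  rewrite inE/= => rU; rewrite /h le_min lexx/= le_max; apply/orP; right.
  by rewrite lerBrDr addrC ltW.
move: hn; rewrite distrC => /ltr_normlW; rewrite ltrBlDr => /ltW/le_trans.
apply.
by rewrite [leRHS]splitr lerD2l.
Qed.

End stable_convergence.

Lemma measurable_probability_leU2 d (T : measurableType d) (R : realType)
    (P : probability T R) (A B : set T) (a b : R) :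
  measurable A -> measurable B -> (P A <= a%:E)%E -> (P B <= b%:E)%E ->
  (P (A `|` B) <= (a + b)%:E)%E.
Proof.
move=> mA mB PA PB; apply: le_trans (measureU2 _ mA mB) _.
by rewrite EFinD leeD.
Qed.

Lemma mulmx_continuous (R : realType) m n k (A : 'M[R]_(m, n)) :
  continuous (fun x : 'M[R]_(n, k) => A *m x).
Proof.
move=> x V /= /nbhs_ballP[e /= e0 eV]; apply/nbhs_ballP.
have c0 : 0 < n%:R * `|A| + 1 by rewrite ltr_pwDr// mulr_ge0.
exists (e / (n%:R * `|A| + 1)); first by rewrite /= divr_gt0.
move=> y; rewrite mx_norm_ball /ball_/= ltr_pdivlMr// => xy.
apply: eV; rewrite mx_norm_ball /ball_/= -mulmxBr.
rewrite (le_lt_trans (mulmx_norm _ _))// (le_lt_trans _ xy)// [leRHS]mulrC.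
by rewrite ler_wpM2r// lerDl.
Qed.

(** Three comparisons: the expectation with [X n] against [SX n], [SX n] against [SZ], and [SZ]
    against the limit. The middle one is stable convergence with the variables [Y * \1_(D j)] and
    the functions [h (t j *m x)]; the outer ones are simple approximations. *)
Lemma stable_cvg_mulmx d d' (Omega : measurableType d)
    (Omega' : measurableType d') (R : realType) (P : probability Omega R)
    (Pbar : probability (Omega * Omega')%type R) (p : nat)
    (U X : nat -> Omega -> 'cV[R]_p) (Z : Omega * Omega' -> 'cV[R]_p)
    (T : Omega -> 'M[R]_p) :
  is_extension P Pbar ->
  (forall n, mx_measurable (U n)) -> (forall n, mx_measurable (X n)) ->
  mx_measurable Z -> mx_measurable T -> stable_cvg P Pbar U Z ->
  (forall g e : R, 0 < g -> 0 < e -> \forall n \near \oo,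
    (P [set w | g < `|X n w - T w *m U n w|]%R <= e%:E)%E) ->
  stable_cvg P Pbar X (fun z => T z.1 *m Z z).
Proof.
move=> ext mU mX mZ mT UZ XTU Y h mY [K YK] ch [H hH].
have K0 : 0 <= K by exact: le_trans (YK point).
have H0 : 0 <= H by exact: le_trans (hH 0).
have mTZ : mx_measurable (fun z => T z.1 *m Z z).
  apply: mx_measurableM => // i j.
  exact: (measurableT_comp (mT i j) measurable_fst).
have mYf : measurable_fun setT (Y \o @fst Omega Omega').
  exact: measurableT_comp mY measurable_fst.
rewrite (@expectationE _ _ _ _ _ (K * H)); last 2 first.
- by apply: measurable_funM => //; exact: mx_measurable_comp mTZ ch.
- by move=> z; rewrite normrM ler_pM.
have XE n : ('E_P[(fun w => Y w * h (X n w))%R] =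
    (\int[P]_w (Y w * h (X n w)))%R%:E)%E.
  apply: (@expectationE _ _ _ _ _ (K * H)) => [|w].
    by apply: measurable_funM => //; exact: mx_measurable_comp (mX n) ch.
  by rewrite normrM ler_pM.
under eq_fun do rewrite XE.
apply: cvg_EFin; first by apply: nearW.
apply/cvgrPdist_le => e0 e0_gt0.
(* [C] is the sum of the coefficients of [e] in [Zbound], [Xbound] and [Sbound]. *)
pose C := 4 * K + 14 * (K * H) + 1.
have C0 : 0 < C by rewrite ltr_pwDr// addr_ge0// !mulr_ge0.
pose e := e0 / C.
have e_gt0 : 0 < e by rewrite divr_gt0.
have [s s0 Ts] := norm_tight P mT e_gt0.
have [r1 r1_gt0 Ur1] := stable_cvg_tight mU mZ UZ e_gt0.
have [r2 r2_gt0 Zr2] := norm_tight Pbar mZ e_gt0.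
pose r := Num.max r1 r2.
have r_gt0 : 0 < r by rewrite lt_max r1_gt0.
(* The radius bounds [T w *m u] when [T w] has norm at most [s] and [u] at most [r]. *)
have [g g0 hg] := cV_unif_continuous (p%:R * s * r) ch e_gt0.
(* Chosen so that moving the matrix by [rho] moves its product with a vector of norm at most [r] by
   at most [g]; [p.+1] avoids dividing by 0 when [p] is 0. *)
pose rho := g / (p.+1%:R * r).
have rho0 : 0 < rho by rewrite divr_gt0// mulr_gt0.
have [t [D [N [B [mD tD mB PB Bt]]]]] :=
  countable_partition_small P mT rho0 e_gt0.
(* The deterministic comparison behind both outer bounds: one [e] for passing from [x] to
   [T w *m u], another for replacing [T w] by [t j]. *)
have key w (u x : 'cV[R]_p) : ~ B w -> `|T w| <= s -> `|u| <= r ->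
    `|x - T w *m u| <= g -> exists j,
    [/\ (j < N)%N, D j w & `|h x - h (t j *m u)| <= 2 * e].
  move=> /Bt[j [jN Djw Tt]] Tws ur xg; exists j; split => //.
  have TuL : `|T w *m u| <= p%:R * s * r.
    apply: le_trans (mulmx_norm _ _) _.
    by rewrite ler_pM ?mulr_ge0// ler_wpM2l.
  rewrite -(subrKA (h (T w *m u))) (le_trans (ler_normD _ _))//.
  rewrite mulr2n mulrDl mul1r lerD//; first by rewrite distrC hg// distrC.
  apply: hg => //; rewrite -mulmxBl (le_trans (mulmx_norm _ _))//.
  have -> : g = p.+1%:R * rho * r.
    by rewrite /rho; field; rewrite gt_eqF//= nat1r pnatr_eq0.
  rewrite ler_pM ?mulr_ge0//; rewrite ler_pM// ?ler_nat//; exact: ltW.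
have mTs : measurable [set w | s < `|T w|].
  by apply: measurable_set_lt => //; exact: mx_measurable_norm.
pose SX n := \sum_(j < N)
  \int[P]_w (Y w * \1_(D j) w * h (t j *m U n w)).
pose SZ := \sum_(j < N)
  \int[Pbar]_z (Y z.1 * \1_(D j) z.1 * h (t j *m Z z)).
have SXZ : SX n @[n --> \oo] --> SZ.
  apply: cvg_big => [|j _]; first exact: add_continuous.
  apply: (stable_cvg_Rintegral mU mZ UZ (Y := fun w => Y w * \1_(D j) w)
    (h := fun x => h (t j *m x)) (K := K) (H := H)) => //.
  - by apply: measurable_funM => //; exact: measurable_indic.
  - move=> w; rewrite normrM indicE; case: (_ \in _).
      by rewrite normr1 mulr1.
    by rewrite normr0 mulr0.
  - move=> x; apply: continuous_comp; first exact: mulmx_continuous.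
    exact: ch.
have Zbound : `|\int[Pbar]_z (Y z.1 * h (T z.1 *m Z z)) - SZ| <=
    K * (2 * e) + 2 * (K * H) * (3 * e).
  pose BZ := (fst @^-1` (B `|` [set w | s < `|T w|])) `|`
    [set z : Omega * Omega' | r2 < `|Z z|].
  have mBT : measurable (B `|` [set w | s < `|T w|]) by exact: measurableU.
  have mBZ1 : measurable (@fst Omega Omega' @^-1` (B `|` [set w | s < `|T w|])).
    by rewrite -[X in measurable X]setTI; exact: measurable_fst.
  have mBZ2 : measurable [set z : Omega * Omega' | r2 < `|Z z|].
    by apply: measurable_set_lt => //; exact: mx_measurable_norm.
  have mBZ : measurable BZ by exact: measurableU.
  (* Two of the three bad events depend on the first coordinate only, so the extension property
     gives them their probability under [P]. *)
  have PBZ : (Pbar BZ <= (3 * e)%:E)%E.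
    have -> : 3 * e = (e + e) + e by ring.
    apply: measurable_probability_leU2 => //.
    have -> : @fst Omega Omega' @^-1` (B `|` [set w | s < `|T w|]) =
        (B `|` [set w | s < `|T w|]) `*` setT.
      by apply/seteqP; split => [z //=|z []].
    by rewrite ext//; exact: measurable_probability_leU2.
  have := @Rintegral_simple_approx _ _ _ _ _ Pbar fst p Y Z
    (fun z => T z.1 *m Z z) h D t N BZ K H (2 * e) measurable_fst mY mZ mTZ ch
    YK hH _ mD tD mBZ.
  move/(_ (mulr_ge0 (ler0n _ _) (ltW e_gt0))) => bound.
  apply: le_trans (bound _) _.
    move=> z nB; apply: key.
    - by move=> Bz; apply: nB; left; left.
    - by rewrite leNgt; apply/negP => ?; apply: nB; left; right.
    - rewrite le_max; apply/orP; right.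
      by rewrite leNgt; apply/negP => ?; apply: nB; right.
    - by rewrite subrr normr0 ltW.
  by rewrite lerD2l ler_wpM2l ?mulr_ge0//; exact: fine_probability_le.
near=> n.
have Xbound : `|\int[P]_w (Y w * h (X n w)) - SX n| <=
    K * (2 * e) + 2 * (K * H) * (4 * e).
  have mTU : mx_measurable (fun w => X n w - T w *m U n w).
    apply: mx_measurableD => //; apply: mx_measurableN.
    exact: mx_measurableM.
  have mB1 : measurable [set w | r1 < `|U n w|].
    by apply: measurable_set_lt => //; exact: mx_measurable_norm.
  have mB2 : measurable [set w | g < `|X n w - T w *m U n w|].
    by apply: measurable_set_lt => //; exact: mx_measurable_norm.
  pose BX := (B `|` [set w | s < `|T w|]) `|` [set w | r1 < `|U n w|] `|`
    [set w | g < `|X n w - T w *m U n w|].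
  have mBX : measurable BX by do 3 apply: measurableU => //.
  have PBX : (P BX <= (4 * e)%:E)%E.
    have -> : 4 * e = (e + e + e) + e by ring.
    apply: measurable_probability_leU2 => //.
    - by do 2 apply: measurableU => //.
    - apply: measurable_probability_leU2 => //; first exact: measurableU.
        exact: measurable_probability_leU2.
      by near: n.
    - by near: n; exact: XTU.
  have := @Rintegral_simple_approx _ _ _ _ _ P id p Y (U n) (X n) h D t N BX
    K H (2 * e) (@measurable_id _ _ setT) mY (mU n) (mX n) ch YK hH _ mD tD mBX.
  move/(_ (mulr_ge0 (ler0n _ _) (ltW e_gt0))) => bound.
  apply: le_trans (bound _) _.
    move=> w nB; apply: key.
    - by move=> Bz; apply: nB; left; left; left.
    - by rewrite leNgt; apply/negP => ?; apply: nB; left; left; right.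
    - rewrite le_max; apply/orP; left.
      by rewrite leNgt; apply/negP => ?; apply: nB; left; right.
    - by rewrite leNgt; apply/negP => ?; apply: nB; right.
  by rewrite lerD2l ler_wpM2l ?mulr_ge0//; exact: fine_probability_le.
have Sbound : `|SZ - SX n| <= e.
  by near: n; move/cvgrPdist_le : SXZ; exact.
have -> : e0 = (K * (2 * e) + 2 * (K * H) * (3 * e)) + e +
    (K * (2 * e) + 2 * (K * H) * (4 * e)).
  have <- : e * C = e0 by rewrite /e divfK// gt_eqF.
  by rewrite /C; ring.
rewrite -(subrKA SZ) (le_trans (ler_normD _ _))// -addrA lerD//.
rewrite -(subrKA (SX n)) (le_trans (ler_normD _ _))// lerD//.
by rewrite distrC.
Unshelve. all: by end_near. Qed.

(** * The mean value step *)

Lemma deriveE_Jac (R : realType) p (f : 'cV[R]_p -> 'cV[R]_p) x v :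
  differentiable f x -> 'D_v f x = Jac f x *m v.
Proof.
move=> df; rewrite deriveE// {1}(matrix_sum_delta v) linear_sum.
apply/matrixP => i j; rewrite summxE mxE.
apply: eq_bigr => k _; rewrite big_ord1 linearZ/= !mxE (ord1 j) deriveE//.
by rewrite mulrC.
Qed.

(** The difference quotient along the line is a continuous linear functional of the difference
    quotient of [f] in direction [v], so the limit passes through it. *)
Lemma is_derive_line (R : realType) p (f : 'cV[R]_p -> 'cV[R]_p)
    (A : 'M[R]_p) x v (t : R) i :
  differentiable f (x + t *: v) ->
  is_derive t 1 (fun s : R => (A *m f (x + s *: v)) i ord0)
    ((A *m (Jac f (x + t *: v) *m v)) i ord0).
Proof.
move=> df; rewrite -deriveE_Jac//.
pose dq (h : R) := h^-1 *:
  ((f \o shift (x + t *: v)) (h *: v) - f (x + t *: v)).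
have df' : dq @ 0^' --> 'D_v f (x + t *: v).
  exact: diff_derivable.
have cL : continuous (fun y : 'cV[R]_p => (A *m y) i ord0).
  move=> y; exact: (continuous_comp (@mulmx_continuous _ _ _ _ A y)
    (@coord_continuous _ _ _ i ord0 _)).
have : (fun h : R => h^-1 *:
    (((fun s : R => (A *m f (x + s *: v)) i ord0) \o shift t) (h *: 1) -
      (A *m f (x + t *: v)) i ord0)) @ 0^' -->
    (A *m 'D_v f (x + t *: v)) i ord0.
  rewrite (_ : (fun h : R => _) = (fun y : 'cV[R]_p => (A *m y) i ord0) \o
    dq).
    exact: (continuous_cvg _ (cL _) df').
  apply/funext => h /=.
  have -> : x + shift t (h *: 1) *: v = shift (x + t *: v) (h *: v).
    by rewrite /shift/= [h *: 1]mulr1 scalerDl addrCA.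
  by rewrite -scalemxAr mulmxBr !mxE.
move=> L; apply: DeriveDef; first by apply/cvg_ex; eexists; exact: L.
exact/cvg_lim.
Qed.

(** The scalar mean value theorem is applied to each coordinate of [A *m f] along the segment. The
    intermediate point depends on the coordinate, which is harmless because the bound on the
    Jacobians is uniform over the segment. *)
Lemma mean_value_residual (R : realType) p (f : 'cV[R]_p -> 'cV[R]_p)
    (A W : 'M[R]_p) x y (e : R) :
  A \in unitmx ->
  (forall t : R, 0 <= t <= 1 -> differentiable f (x + t *: (y - x))) ->
  (forall t : R, 0 <= t <= 1 ->
    `|A *m Jac f (x + t *: (y - x)) *m invmx A - W| <= e) ->
  `|A *m (f y - f x) - W *m (A *m (y - x))| <=
  p%:R * e * `|A *m (y - x)|.
Proof.
move=> uA df We; set v := y - x.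
have e0 : 0 <= e by apply: le_trans (We 0 _); rewrite ?lexx ?ler01.
apply: mx_norm_le => [|i j]; first by rewrite !mulr_ge0.
rewrite (ord1 j) => {j}.
pose phi (t : R) : R := (A *m f (x + t *: v)) i ord0.
have dphi (t : R) : 0 <= t <= 1 -> is_derive t 1 phi
    ((A *m (Jac f (x + t *: v) *m v)) i ord0).
  by move=> t01; apply: is_derive_line; exact: df.
have [||c c01] := @MVT_segment R phi
    (fun t => (A *m (Jac f (x + t *: v) *m v)) i ord0) 0 1 ler01.
- move=> t; rewrite in_itv/= => /andP[t0 t1]; apply: dphi.
  by rewrite !ltW.
- apply: derivable_within_continuous => t; rewrite in_itv/= => t01.
  by have [] := dphi t t01.
rewrite subr0 mulr1 /phi scale0r addr0 scale1r subrKC => phic.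
(* Inserting [invmx A *m A] before [v] exhibits the normalized Jacobian acting on [A *m v]. *)
have -> : (A *m (f y - f x) - W *m (A *m v)) i ord0 =
    ((A *m Jac f (x + c *: v) *m invmx A - W) *m (A *m v)) i ord0.
  rewrite mulmxBl mulmxBr -!mulmxA (mulmxA (invmx A)) mulVmx// mul1mx.
  by rewrite !mxE in phic *; rewrite phic.
apply: le_trans (mx_entry_le _ _ _) _; apply: le_trans (mulmx_norm _ _) _.
by rewrite ler_wpM2r// ler_wpM2l// We// -in_itv.
Qed.

(** A deterministic step: [X + invmx W0 *m U] is [invmx W0] applied to the residual [U + W0 *m X],
    hence small relative to [X]. The first smallness condition on [e] bounds [X]; the other two give
    the two conclusions. *)
Lemma newton_bound (R : realType) p (W0 W1 : 'M[R]_p) (U X : 'cV[R]_p)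
    (c r e g : R) :
  W0 \in unitmx -> `|invmx W0| <= c -> `|U| <= r -> `|W1 - W0| <= e ->
  `|U + W0 *m X| <= p%:R * e * `|X| ->
  e * (p%:R ^+ 2 * c) <= 1 / 2 ->
  e * (2 * p%:R ^+ 3 * c ^+ 2 * r) <= g ->
  e * (4 * p%:R ^+ 2 * c * r) <= g ->
  `|X + invmx W0 *m U| <= g /\ `|W1 *m X + U| <= g.
Proof.
move=> uW0 W0c Ur We UX e1 e2 e3.
set q : R := p%:R in UX e1 e2 e3.
have q0 : 0 <= q by rewrite /q.
have c0 : 0 <= c by exact: le_trans W0c.
have r0 : 0 <= r by exact: le_trans Ur.
have e0 : 0 <= e by exact: le_trans We.
have XE : X + invmx W0 *m U = invmx W0 *m (U + W0 *m X).
  by rewrite mulmxDr mulmxA mulVmx// mul1mx addrC.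
have XU : `|X + invmx W0 *m U| <= e * (q ^+ 2 * c) * `|X|.
  rewrite XE (le_trans (mulmx_norm _ _))//.
  have -> : e * (q ^+ 2 * c) * `|X| = q * c * (q * e * `|X|) by ring.
  by rewrite ler_pM// ?mulr_ge0// ler_wpM2l.
(* Absorption: [X] is bounded by half its own norm plus the norm of [invmx W0 *m U]. *)
have X2 : `|X| <= 2 * q * c * r.
  have : `|X| <= 1 / 2 * `|X| + q * c * r.
    rewrite -[in leLHS](addrK (invmx W0 *m U) X).
    rewrite (le_trans (ler_normB _ _))// lerD//.
      by rewrite (le_trans XU)// ler_wpM2r.
    by rewrite (le_trans (mulmx_norm _ _))// ler_pM ?mulr_ge0// ler_wpM2l.
  by move=> ?; lra.
split.
  apply: le_trans XU _; apply: le_trans e2.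
  have -> : e * (2 * q ^+ 3 * c ^+ 2 * r) =
    e * (q ^+ 2 * c) * (2 * q * c * r) by ring.
  by rewrite ler_wpM2l// !mulr_ge0// exprn_ge0.
have -> : W1 *m X + U = (W1 - W0) *m X + (U + W0 *m X).
  by rewrite mulmxBl addrACA addNr addr0.
have W1X : `|(W1 - W0) *m X| <= q * e * `|X|.
  by rewrite (le_trans (mulmx_norm _ _))// ler_wpM2r// ler_wpM2l.
apply: le_trans (ler_normD _ _) _; apply: le_trans (lerD W1X UX) _.
apply: le_trans e3.
have -> : q * e * `|X| + q * e * `|X| = 2 * q * e * `|X| by ring.
have -> : e * (4 * q ^+ 2 * c * r) = 2 * q * e * (2 * q * c * r) by ring.
by rewrite ler_wpM2l// !mulr_ge0.
Qed.

(** * Outer probability and random fields *)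

Section outer_probability.
Context d (T : measurableType d) (R : realType) (P : probability T R).

(** Outer measure is an infimum over countable measurable covers; the union of a nearly optimal
    cover replaces a possibly non-measurable event. *)
Lemma mu_ext_lt_measurable (E : set T) (e : R) : ((P^*)%mu E < e%:E)%E ->
  exists B, [/\ measurable B, E `<=` B & (P B <= e%:E)%E].
Proof.
move=> /ereal_inf_lt[_ [C [mC EC] <-] Ce].
exists (\bigcup_k C k); split => //; first exact: bigcupT_measurable.
apply: le_trans (ltW Ce); apply: measure_sigma_subadditive => //.
exact: bigcupT_measurable.
Qed.

Lemma cvg_prob0_near (X : nat -> T -> \bar R) (e g : R) :
  cvg_prob0 P X -> 0 < e -> 0 < g -> \forall n \near \oo,
  exists B, [/\ measurable B, (P B <= g%:E)%E &
    forall w, ~ B w -> (X n w <= e%:E)%E].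
Proof.
move=> X0 e0 g0; have : \forall n \near \oo,
    ((P^*)%mu [set w | (e%:E < X n w)%E] < g%:E)%E.
  move: (X0 e e0) => /(_ [set y | (y < g%:E)%E]); apply.
  apply: (@open_ereal_lt' _ 0%E g%:E).
  by rewrite lte_fin.
apply: filterS => n /mu_ext_lt_measurable[B [mB XB PB]].
exists B; split => // w nB; rewrite leNgt; apply/negP => ?.
by apply: nB; exact: XB.
Qed.

(** Here [n] may depend on [w] and [e]. A point with [X n w] above [1/(j+1)] for every [n] lies in
    all [B (j, m)], whose probabilities are at most [1/(m+1)]; a countable union over [j] stays
    null. *)
Lemma cvg_prob0_ae (X : nat -> T -> \bar R) : cvg_prob0 P X ->
  {ae P, forall w, forall e : R, 0 < e -> exists n, (X n w <= e%:E)%E}.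
Proof.
move=> X0.
have inv0 (k : nat) : 0 < (k.+1%:R^-1 : R) by rewrite invr_gt0.
have /choice[B BP] : forall jm : nat * nat, exists B, [/\ measurable B,
    (P B <= (jm.2.+1%:R^-1)%:E)%E & exists n, forall w, ~ B w ->
    (X n w <= (jm.1.+1%:R^-1)%:E)%E].
  move=> [j m] /=; have [n _ /(_ n (leqnn n))] :=
    cvg_prob0_near X0 (inv0 j) (inv0 m).
  by move=> [B [mB PB XB]]; exists B; split => //; exists n.
have mB j : measurable (\bigcap_m B (j, m)).
  by apply: bigcapT_measurable => m; have [] := BP (j, m).
apply: (@negligibleS _ _ _ _ (\bigcup_j \bigcap_m B (j, m))); last first.
  apply: negligible_bigcup => j; exists (\bigcap_m B (j, m)); split => //.
  apply/eqP; rewrite eq_le measure_ge0 andbT.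
  apply/lee_addgt0Pr => e e0; rewrite add0e.
  have [k _ /(_ k (leqnn k))/= ke] := near_infty_natSinv_lt (PosNum e0).
  have [mBk PBk _] := BP (j, k).
  apply: (@le_trans _ _ (P (B (j, k)))).
    by apply: le_measure; rewrite ?inE//; move=> w; exact.
  by rewrite (le_trans PBk)// lee_fin ltW.
move=> w /= nX; apply: contrapT => nN; apply: nX => e e0.
have [k _ /(_ k (leqnn k))/= ke] := near_infty_natSinv_lt (PosNum e0).
have [m nB] : exists m, ~ B (k, m) w.
  apply: contrapT => nB; apply: nN; exists k => // m _.
  by apply: contrapT => nBm; apply: nB; exists m.
have [_ _ [n XB]] := BP (k, m).
by exists n; rewrite (le_trans (XB _ nB))// lee_fin ltW.
Qed.

End outer_probability.

(* The events are measurable because by continuity rational points suffice. *)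
Lemma random_field_osc_small d (T : measurableType d) (R : realType)
    (P : probability T R) p m n (W : 'M[R]_(p, 1) -> T -> 'M[R]_(m, n))
    (x0 : 'cV[R]_p) (r0 e g : R) :
  0 < r0 -> (forall x, `|x - x0| < r0 -> mx_measurable (W x)) ->
  {ae P, forall w, forall x, `|x - x0| < r0 -> forall e : R, 0 < e ->
    exists2 b, 0 < b & forall y, `|y - x| < b -> `|W y w - W x w| <= e} ->
  0 < e -> 0 < g ->
  exists r B, [/\ 0 < r <= r0, measurable B, (P B <= g%:E)%E &
    forall w, ~ B w -> forall x, `|x - x0| < r -> `|W x w - W x0 w| <= e].
Proof.
move=> r0_gt0 mW [N [mN PN cW]] e0 g0.
have x0r : `|x0 - x0| < r0 by rewrite subrr normr0.
pose r (k : nat) := r0 / k.+1%:R.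
have r_gt0 k : 0 < r k by rewrite divr_gt0.
have r_le k : r k <= r0 by rewrite ler_pdivrMr// ler_peMr ?(ltW r0_gt0)// ler1n.
pose emb (q : 'M[rat]_(p, 1)) : 'cV[R]_p := map_mx ratr q.
pose F k q := [set w | `|emb q - x0| < r k /\ e < `|W (emb q) w - W x0 w|].
pose E k := \bigcup_q F k q.
have mE k : measurable (E k).
  apply: countable_bigcupT_measurable => // q.
  have [qr|qr] := ltP `|emb q - x0| (r k); last first.
    rewrite (_ : F k q = set0)//; apply/seteqP; split => // w [].
    by rewrite ltNge qr.
  rewrite (_ : F k q = [set w | e < `|W (emb q) w - W x0 w|]); last first.
    by apply/seteqP; split => w; [move=> []|move=> ?; split].
  apply: measurable_set_lt => //; apply: mx_measurable_norm.
  apply: mx_measurableD; first by apply: mW; exact: lt_le_trans qr _.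
  by apply: mx_measurableN; exact: mW.
have [k PE] : exists k, (P (E k) <= g%:E)%E.
  apply: probability_decreasing_small => //.
    move=> k w [q _ [qr eW]]; exists q => //; split => //.
    apply: lt_le_trans qr _; rewrite ler_pM2l// lef_pV2 ?posrE//.
    by rewrite ler_nat.
  (* The radii [r k] tend to 0, so a point in every [E k] violates continuity at [x0] and lies in
     the null set [N]. *)
  apply/eqP; rewrite eq_le measure_ge0 andbT -PN.
  apply: le_measure; rewrite ?inE//; first exact: bigcapT_measurable.
  move=> w Ew; apply: cW => /(_ x0 x0r _ e0)[b b0 Wb].
  have b'0 : 0 < b / r0 by rewrite divr_gt0.
  have [k _ /(_ k (leqnn k))/= kb] := near_infty_natSinv_lt (PosNum b'0).
  have [q _ [qr eW]] := Ew k I.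
  have : `|W (emb q) w - W x0 w| <= e.
    apply: Wb; apply: lt_trans qr _; rewrite /r mulrC.
    by rewrite -ltr_pdivlMr.
  by rewrite leNgt eW.
exists (r k), (E k `|` N); split; first by rewrite r_gt0 r_le.
- exact: measurableU.
- by rewrite -(addr0 g); apply: measurable_probability_leU2; rewrite ?PN.
move=> w nB x xr; rewrite leNgt; apply/negP => eW; apply: nB.
have [Nw|nN] := pselect (N w); [by right|left].
have cWw : forall x, `|x - x0| < r0 -> forall e : R, 0 < e ->
    exists2 b, 0 < b & forall y, `|y - x| < b -> `|W y w - W x w| <= e.
  by apply: contrapT => ncW; apply: nN; exact: cW.
(* Half the excess over [e]: a rational point whose value is within [e1] of that at [x] still
   exceeds [e], and so witnesses [E k]. *)
pose e1 := (`|W x w - W x0 w| - e) / 2.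
have e1_gt0 : 0 < e1 by rewrite divr_gt0// subr_gt0.
have [b b0 Wb] := cWw x (lt_le_trans xr (r_le k)) _ e1_gt0.
have b'0 : 0 < Num.min b (r k - `|x - x0|) by rewrite lt_min b0 subr_gt0.
have [q xq] := mx_rat_dense x b'0.
move: xq; rewrite lt_min => /andP[xqb xqr].
exists q => //; split.
  rewrite -(subrKA x) (le_lt_trans (ler_normD _ _))// -ltrBrDr distrC.
  exact: xqr.
have Wq : `|W (emb q) w - W x w| <= e1 by apply: Wb; rewrite distrC.
have : `|W x w - W x0 w| <= `|W (emb q) w - W x0 w| + e1.
  rewrite -(subrKA (W (emb q) w)) (le_trans (ler_normD _ _))// addrC lerD//.
  by rewrite distrC.
by rewrite /e1 in e1_gt0 *; lra.
Qed.

(** * Consequences of the hypotheses at a fixed parameter or a fixed outcome *)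

(** Sections of product-measurable sets are measurable: the sets whose section at [theta] lies in
    [F] form a sigma-algebra containing the rectangles. *)
Lemma estimating_function_measurable (R : realType) p (Omega : Type)
    (Theta : set 'cV[R]_p) (F : set (set Omega))
    (G : 'cV[R]_p -> Omega -> 'cV[R]_p) theta :
  sigma_algebra setT F -> estimating_function Theta F G -> Theta theta ->
  measurable_wrt setT F (G theta).
Proof.
move=> [F0 FC FU] efG Ttheta B mB; rewrite setTI.
have -> : G theta @^-1` B = [set w | (Theta `*` setT `&`
    (fun z => G z.1 z.2) @^-1` B) (theta, w)].
  by apply/seteqP; split => w //= [].
move: (_ `&` _) (efG B mB).
apply: smallest_sub; last first.
  move=> _ [A _ [C FC' <-]] /=.
  have [At|nAt] := pselect (A theta).
    by rewrite (_ : mkset _ = C)//; apply/seteqP; split => w //= [].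
  by rewrite (_ : mkset _ = set0)//; apply/seteqP; split => w //= [].
split => [|A mA|A mA] /=.
- by rewrite (_ : mkset _ = set0).
- rewrite (_ : mkset _ = setT `\` [set w | A (theta, w)]); first exact: FC.
  by apply/seteqP; split => w /= [].
- rewrite (_ : mkset _ = \bigcup_k [set w | A k (theta, w)]); first exact: FU.
  by apply/seteqP; split => w [k _ Ak]; exists k.
Qed.

Lemma sup_opnorm_le (R : realType) p (M : set 'cV[R]_p)
    (H : 'cV[R]_p -> 'M[R]_p) (e : R) x :
  (sup_opnorm M H <= e%:E)%E -> M x -> `|H x| <= e.
Proof.
move=> /ereal_supP He Mx; apply: le_trans (norm_le_opnorm _) _.
by rewrite -lee_fin; apply: He; exists x.
Qed.

Lemma C1_on_Jac_continuous (R : realType) p (M : set 'cV[R]_p) f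
    (x : 'cV[R]_p) (e : R) :
  C1_on M f -> nbhs x M -> 0 < e ->
  exists2 b : R, 0 < b & forall y, `|y - x| < b -> `|Jac f y - Jac f x| <= e.
Proof.
move=> [_ cJ] xM e0.
have : nbhs x (Jac f @^-1` ball (Jac f x) e).
  rewrite (nbhs_subspace_interior xM).
  by apply: (cJ x); exact: nbhsx_ballx.
move=> /nbhs_ballP[b /= b0 bJ]; exists b => // y xy.
have /bJ : ball x b y by rewrite mx_norm_ball /ball_/= distrC.
by rewrite /= mx_norm_ball /ball_/= distrC => /ltW.
Qed.

Lemma norm_mulmx_sub_le (R : realType) p (A B J K : 'M[R]_p) :
  `|A *m J *m B - A *m K *m B| <=
  (p%:R * (p%:R * `|A|) * `|B|) * `|J - K|.
Proof.
rewrite -mulmxBl -mulmxBr (le_trans (mulmx_norm _ _))//.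
have -> : p%:R * (p%:R * `|A|) * `|B| * `|J - K| =
    p%:R * (p%:R * `|A| * `|J - K|) * `|B| by ring.
by rewrite ler_wpM2r// ler_wpM2l// mulmx_norm.
Qed.

(** The three-epsilon argument with a single index [n]; the normalized Jacobian is continuous
    because conjugation by a fixed [A n] is Lipschitz. *)
Lemma uniform_limit_continuous (R : realType) p (M M' : set 'cV[R]_p)
    (f : nat -> 'cV[R]_p -> 'cV[R]_p) (A : nat -> 'M[R]_p)
    (W : 'cV[R]_p -> 'M[R]_p) (x : 'cV[R]_p) (e : R) :
  (forall n, C1_on M (f n)) ->
  (forall e : R, 0 < e -> exists n, (sup_opnorm M' (fun y =>
    A n *m Jac (f n) y *m invmx (A n) - W y)%R <= e%:E)%E) ->
  nbhs x M -> nbhs x M' -> 0 < e ->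
  exists2 b : R, 0 < b & forall y, `|y - x| < b -> `|W y - W x| <= e.
Proof.
move=> C1f supW xM xM' e0.
have e3 : 0 < e / 3 by rewrite divr_gt0.
have [n /sup_opnorm_le Wn] := supW _ e3.
(* The Lipschitz constant from [norm_mulmx_sub_le], plus 1 for positivity. *)
pose c := p%:R * (p%:R * `|A n|) * `|invmx (A n)| + 1.
have c0 : 0 < c by rewrite ltr_pwDr// !mulr_ge0.
have ec0 : 0 < e / 3 / c by rewrite divr_gt0.
have [b b0 bJ] := C1_on_Jac_continuous (C1f n) xM ec0.
have /nbhs_ballP[b' /= b'0 b'M] := xM'.
exists (Num.min b b') => [|y]; first by rewrite lt_min b0.
rewrite lt_min => /andP[yb yb'].
have M'y : M' y by apply: b'M; rewrite mx_norm_ball /ball_/= distrC.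
have W1 := Wn _ M'y; have W2 := Wn _ (nbhs_singleton xM').
have W3 : `|A n *m Jac (f n) y *m invmx (A n) -
    A n *m Jac (f n) x *m invmx (A n)| <= e / 3.
  apply: le_trans (norm_mulmx_sub_le _ _ _ _) _.
  have -> : e / 3 = c * (e / 3 / c) by rewrite [RHS]mulrC divfK// gt_eqF.
  by rewrite ler_pM ?mulr_ge0// ?lerDl// bJ.
set J1 := A n *m Jac (f n) y *m _ in W1 W3.
set J2 := A n *m Jac (f n) x *m _ in W2 W3.
have -> : W y - W x = - (J1 - W y) + (J1 - J2) + (J2 - W x).
  by rewrite opprB !subrKA.
have -> : e = e / 3 + e / 3 + e / 3 by field.
rewrite (le_trans (ler_normD _ _))// lerD//.
by rewrite (le_trans (ler_normD _ _))// lerD// normrN.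
Qed.

(** The extra point is at distance 1 from every parameter, so a distance below 1 forces a genuine
    parameter value. *)
Lemma dist_delta_le (R : realType) p (x : option 'cV[R]_p) y (e : R) :
  e < 1 -> dist_delta x (Some y) <= e ->
  exists2 z, x = Some z & `|z - y| <= e.
Proof.
case: x => [z|] /= e1 xy; last by move: e1; rewrite ltNge xy.
by exists z => //; apply: le_trans (norm_le_enorm _) xy.
Qed.

Lemma exists_small_factor (R : realType) (k1 k2 k3 g : R) :
  0 <= k1 -> 0 <= k2 -> 0 <= k3 -> 0 < g ->
  exists2 e : R, 0 < e & [/\ e * k1 <= 1 / 2, e * k2 <= g & e * k3 <= g].
Proof.
move=> k10 k20 k30 g0.
have small k d : 0 <= k -> 0 < d -> 0 < d / (k + 1) /\
    forall e : R, 0 < e -> e <= d / (k + 1) -> e * k <= d.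
  move=> k_ge0 d0; have k_gt0 : 0 < k + 1 by rewrite ltr_pwDr.
  split=> [|e e0]; first by rewrite divr_gt0.
  rewrite ler_pdivlMr// => /(le_trans _); apply.
  by rewrite ler_pM2l// lerDl.
have [a1 b1] := small k1 (1 / 2) k10 ltac:(by rewrite divr_gt0).
have [a2 b2] := small k2 g k20 g0.
have [a3 b3] := small k3 g k30 g0.
exists (Num.min (1 / 2 / (k1 + 1)) (Num.min (g / (k2 + 1)) (g / (k3 + 1)))).
  by rewrite !lt_min a1 a2 a3.
have m0 : 0 <
    Num.min (1 / 2 / (k1 + 1)) (Num.min (g / (k2 + 1)) (g / (k3 + 1))).
  by rewrite !lt_min a1 a2 a3.
by split; [apply: b1|apply: b2|apply: b3] => //; rewrite !ge_min lexx ?orbT.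
Qed.

(** * The Newton step off a small exceptional event, and the two stable limits *)

Theorem theorem2p11 (R : realType) (p : nat)
    (d : measure_display) (Omega : measurableType d) (P : probability Omega R)
    (P_complete : measure_is_complete P)
    (Theta : set 'cV[R]_p)
    (F : nat -> set (set Omega))
    (F_sub : forall n, complete_sub_sigma_field P (F n))
    (Gn : nat -> 'cV[R]_p -> Omega -> 'cV[R]_p)
    (Gn_ef : forall n, estimating_function Theta (F n) (Gn n))
    (thetabar : 'cV[R]_p) (thetabar_int : interior Theta thetabar)
    (M : set 'cV[R]_p) (M_nbhs : nbhs thetabar M) (M_sub : M `<=` Theta)
    (G : 'cV[R]_p -> Omega -> 'cV[R]_p)
    (G_meas : forall theta, M theta -> random_element (G theta))
    (Gn_thetabar :
      cvg_prob0 P (fun n w => (enorm (Gn n thetabar w))%:E))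
    (G_thetabar : {ae P, forall w, G thetabar w = 0})
    (G_C1 : {ae P, forall w, C1_on M (G ^~ w) /\
                             forall n, C1_on M (Gn n ^~ w)})
    (JacGn_cvg : cvg_prob0 P (fun n w =>
      sup_opnorm M (fun theta =>
        Jac (Gn n ^~ w) theta - Jac (G ^~ w) theta)))
    (JacG_unit : {ae P, forall w, Jac (G ^~ w) thetabar \in unitmx})
    (A : nat -> 'M[R]_p) (A_unit : forall n, A n \in unitmx)
    (invA_cvg : forall i j : 'I_p, (invmx (A n) i j) @[n --> \oo] --> (0 : R))
    (d' : measure_display) (Omega' : measurableType d')
    (Pbar : probability (Omega * Omega')%type R)
    (Pbar_ext : is_extension P Pbar)
    (Z : Omega * Omega' -> 'cV[R]_p) (Z_meas : random_element Z)
    (M' : set 'cV[R]_p) (M'_nbhs : nbhs thetabar M') (M'_sub : M' `<=` Theta)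
    (W : 'cV[R]_p -> Omega -> 'M[R]_p)
    (W_meas : forall theta, M' theta -> random_element (W theta))
    (W_unit : {ae P, forall w, W thetabar w \in unitmx})
    (AGn_cvg : stable_cvg P Pbar (fun n w => A n *m Gn n thetabar w) Z)
    (AJacGn_cvg : cvg_prob0 P (fun n w =>
      sup_opnorm M' (fun theta =>
        A n *m Jac (Gn n ^~ w) theta *m invmx (A n) - W theta w)))
    (theta_hat : nat -> Omega -> option 'cV[R]_p)
    (theta_hat_est :
      forall n, G_estimator Theta (F n) (Gn n) (theta_hat n))
    (theta_hat_cons : weakly_consistent P thetabar theta_hat)
    (* X and V are the two quantities of the conclusion, with arbitrary
       measurable values where theta_hat is delta or not in M *)
    (X V : nat -> Omega -> 'cV[R]_p)
    (X_meas : forall n, random_element (X n))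
    (V_meas : forall n, random_element (V n))
    (X_def : forall n w theta, theta_hat n w = Some theta -> M theta ->
      X n w = A n *m (theta - thetabar))
    (V_def : forall n w theta, theta_hat n w = Some theta -> M theta ->
      V n w = A n *m Jac (Gn n ^~ w) theta *m (theta - thetabar)) :
  stable_cvg P Pbar X (fun z => - (invmx (W thetabar z.1) *m Z z)) /\
  stable_cvg P Pbar V (fun z => - Z z).
Proof.
have M'bar : M' thetabar := nbhs_singleton M'_nbhs.
have Tbar : Theta thetabar := M'_sub _ M'bar.
pose U n w := A n *m Gn n thetabar w.
pose W0 := W thetabar.
have mU n : mx_measurable (U n).
  apply: mx_measurableM; first exact: mx_measurable_cst.
  have [sF FO _] := F_sub n.
  apply: random_element_mx_measurable => B mB; apply: FO.
  exact: (estimating_function_measurable sF (Gn_ef n) Tbar).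
have mW0 : mx_measurable W0 := random_element_mx_measurable (W_meas _ M'bar).
have mW0V : mx_measurable (fun w => invmx (W0 w)) := mx_measurableV mW0.
have mZ := random_element_mx_measurable Z_meas.
have mX n := random_element_mx_measurable (X_meas n).
have mV n := random_element_mx_measurable (V_meas n).
(* One ball on which both [M] and [M'] are neighbourhoods of every point, so that continuity of [W]
   is available throughout it and not only at [thetabar]. *)
have [r0 r0_gt0 r0M] : exists2 r0 : R, 0 < r0 &
    forall x, `|x - thetabar| < r0 -> nbhs x M /\ nbhs x M'.
  have /nbhs_ballP[r0 /= r0_gt0 r0M] : nbhs thetabar (M `&` M').
    exact: filterI.
  exists r0 => // x xr0.
  have xMM' : nbhs x (M `&` M').
    apply/nbhs_ballP; exists (r0 - `|x - thetabar|).
      by rewrite /= subr_gt0.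
    move=> y; rewrite mx_norm_ball /ball_/= => xy; apply: r0M.
    rewrite mx_norm_ball /ball_/= -(subrKA x) (le_lt_trans (ler_normD _ _))//.
    by rewrite distrC -ltrBrDl.
  by split; apply: filterS xMM' => y [].
have cW : {ae P, forall w, forall x, `|x - thetabar| < r0 ->
    forall e : R, 0 < e -> exists2 b, 0 < b &
    forall y, `|y - x| < b -> `|W y w - W x w| <= e}.
  apply: filterS2 G_C1 (cvg_prob0_ae AJacGn_cvg) => w [_ C1w] supw x xr0 e e0.
  have [xM xM'] := r0M x xr0.
  exact: (uniform_limit_continuous C1w supw xM xM' e0).
have [N [mN PN W0N]] : P.-negligible (~` [set w |
    (forall n, C1_on M (Gn n ^~ w)) /\ W0 w \in unitmx]).
  by apply: filterS2 G_C1 W_unit => w [_ C1w] uw.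
have main (g e : R) : 0 < g -> 0 < e -> \forall n \near \oo, exists B,
    [/\ measurable B, (P B <= e%:E)%E & forall w, ~ B w ->
    `|X n w + invmx (W0 w) *m U n w| <= g /\ `|V n w + U n w| <= g].
  (* Five events [B1] to [B5] share the probability [e]; the null set [N] costs nothing. *)
  move=> g0 e0; have e50 : 0 < e / 5 by rewrite divr_gt0.
  have [c c0 Wc] := norm_tight P mW0V e50.
  have [r r_gt0 Ur] := stable_cvg_tight mU mZ AGn_cvg e50.
  have [b b0 [b1 b2 b3]] := @exists_small_factor R (p%:R ^+ 2 * c)
    (2 * p%:R ^+ 3 * c ^+ 2 * r) (4 * p%:R ^+ 2 * c * r) g
    ltac:(by rewrite mulr_ge0 ?exprn_ge0// ltW)
    ltac:(by rewrite !mulr_ge0 ?exprn_ge0// ltW)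
    ltac:(by rewrite !mulr_ge0 ?exprn_ge0// ltW) g0.
  (* The bound [b] is split between the distance of the normalized Jacobian to [W] and the
     oscillation of [W] around [thetabar]. *)
  have b20 : 0 < b / 2 by rewrite divr_gt0.
  have mWr0 x : `|x - thetabar| < r0 -> mx_measurable (W x).
    move=> /r0M[_ xM']; apply: random_element_mx_measurable.
    exact/W_meas/(nbhs_singleton xM').
  have [rho [B1 [/andP[rho0 rhor0] mB1 PB1 oscW]]] :=
    random_field_osc_small r0_gt0 mWr0 cW b20 e50.
  (* Below 1 to exclude the value delta, below [rho] to stay in the ball where the oscillation of
     [W] is controlled. *)
  pose rho' := Num.min (1 / 2) (rho / 2).
  have rho'0 : 0 < rho' by rewrite lt_min !divr_gt0.
  have rho'1 : rho' < 1 by rewrite gt_min; apply/orP; left; lra.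
  have rho'rho : rho' < rho by rewrite gt_min; apply/orP; right; lra.
  near=> n.
  have [B2 [mB2 PB2 AJ]] : exists B, [/\ measurable B, (P B <= (e / 5)%:E)%E &
      forall w, ~ B w -> (sup_opnorm M' (fun theta =>
        A n *m Jac (Gn n ^~ w) theta *m invmx (A n) - W theta w)%R
        <= (b / 2)%:E)%E].
    by near: n; exact: cvg_prob0_near AJacGn_cvg b20 e50.
  have [B3 [mB3 PB3 cons]] : exists B, [/\ measurable B,
      (P B <= (e / 5)%:E)%E & forall w, ~ B w ->
      ((dist_delta (theta_hat n w) (Some thetabar))%:E <= rho'%:E)%E].
    by near: n; exact: cvg_prob0_near theta_hat_cons rho'0 e50.
  have PB5 : (P [set w | r < `|U n w|]%R <= (e / 5)%:E)%E by near: n; exact: Ur.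
  pose B4 := [set w | c < `|invmx (W0 w)|].
  pose B5 := [set w | r < `|U n w|].
  have mB4 : measurable B4.
    by apply: measurable_set_lt => //; exact: mx_measurable_norm.
  have mB5 : measurable B5.
    by apply: measurable_set_lt => //; exact: mx_measurable_norm.
  exists (N `|` (B1 `|` (B2 `|` (B3 `|` (B4 `|` B5))))); split.
  - by do 5 apply: measurableU => //.
  - have -> : e = 0 + (e / 5 + (e / 5 + (e / 5 + (e / 5 + e / 5)))) by field.
    apply: measurable_probability_leU2; rewrite ?PN//.
      by do 4 apply: measurableU => //.
    apply: measurable_probability_leU2 => //.
      by do 3 apply: measurableU => //.
    apply: measurable_probability_leU2 => //.
      by do 2 apply: measurableU => //.
    apply: measurable_probability_leU2 => //; first exact: measurableU.
    exact: measurable_probability_leU2.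
  move=> w; rewrite -![(_ `|` _) w]/(_ \/ _) => /not_orP[nN].
  move=> /not_orP[nB1] /not_orP[nB2] /not_orP[nB3] /not_orP[nB4 nB5].
  have [C1w uW0] : (forall n, C1_on M (Gn n ^~ w)) /\ W0 w \in unitmx.
    by apply: contrapT => nw; apply: nN; exact: W0N.
  have W0c : `|invmx (W0 w)| <= c by rewrite leNgt; apply/negP.
  have Unr : `|U n w| <= r by rewrite leNgt; apply/negP.
  have /(dist_delta_le rho'1)[theta hat_theta theta_rho] :
    dist_delta (theta_hat n w) (Some thetabar) <= rho'.
    by rewrite -lee_fin; exact: cons.
  have theta_near : `|theta - thetabar| < rho by exact: le_lt_trans rho'rho.
  (* If there were no zero, the estimator would be delta, contradicting its value [Some theta]. *)
  have G0 : Gn n theta w = 0.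
    have [_ est_zero est_none] := theta_hat_est n.
    have [hz|nhz] := pselect (has_zero Theta (Gn n) w).
      have [theta' [hat_theta' _ G0]] := est_zero w hz.
      by move: hat_theta'; rewrite hat_theta => -[->].
    by move: hat_theta; rewrite est_none.
  have seg (t : R) : 0 <= t <= 1 ->
      `|thetabar + t *: (theta - thetabar) - thetabar| < rho.
    move=> /andP[t0 t1]; rewrite addrAC subrr add0r normrZ ger0_norm//.
    by rewrite (le_lt_trans _ theta_near)// ler_piMl.
  have JW x : `|x - thetabar| < rho ->
      `|A n *m Jac (Gn n ^~ w) x *m invmx (A n) - W0 w| <= b.
    move=> xrho.
    have M'x : M' x.
      by apply: nbhs_singleton; have [] := r0M x (lt_le_trans xrho rhor0).
    rewrite -(subrKA (W x w)) (le_trans (ler_normD _ _))// [leRHS]splitr.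
    apply: lerD; last exact: oscW.
    exact: (sup_opnorm_le (AJ w nB2) M'x).
  have Mtheta : M theta.
    apply: nbhs_singleton.
    by have [] := r0M theta (lt_le_trans theta_near rhor0).
  have XE := X_def _ _ _ hat_theta Mtheta.
  (* [V n w] is the normalized Jacobian at the estimator applied to [X n w], which is the role of
     [W1] in [newton_bound]. *)
  have VE : V n w = (A n *m Jac (Gn n ^~ w) theta *m invmx (A n)) *m X n w.
    by rewrite (V_def _ _ _ hat_theta Mtheta) XE -!mulmxA (mulmxA (invmx _))
      mulVmx// mul1mx.
  have UX : `|U n w + W0 w *m X n w| <= p%:R * b * `|X n w|.
    have := @mean_value_residual R p (Gn n ^~ w) (A n) (W0 w) thetabar theta b
      (A_unit n).
    rewrite G0 sub0r mulmxN -opprD normrN -XE; apply.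
      move=> t /seg trho; have [dG _] := C1w n; apply: dG.
      by apply: nbhs_singleton; have [] := r0M _ (lt_le_trans trho rhor0).
    by move=> t /seg; exact: JW.
  rewrite VE; exact: newton_bound uW0 W0c Unr (JW _ theta_near) UX b1 b2 b3.
split.
(* The multiplier is the random matrix [- invmx (W0 w)]; for [V] below it is the constant
   [- 1%:M]. *)
- rewrite (_ : (fun z => _) = (fun z => - invmx (W0 z.1) *m Z z)); last first.
    by apply/funext => z; rewrite mulNmx.
  apply: (stable_cvg_mulmx (U := U) (T := fun w => - invmx (W0 w))) => //.
    exact: mx_measurableN.
  move=> g e g0 e0; apply: filterS (main g e g0 e0) => n [B [mB PB XB]].
  apply: le_trans PB; apply: le_measure; rewrite ?inE//.
    apply: measurable_set_lt => //; apply: mx_measurable_norm.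
    apply: mx_measurableD => //; apply: mx_measurableN.
    by apply: mx_measurableM => //; exact: mx_measurableN.
  move=> w /=; rewrite mulNmx opprK ltNge => /negP gX.
  by apply: contrapT => /XB[].
- rewrite (_ : (fun z => _) = (fun z => (- 1%:M) *m Z z)); last first.
    by apply/funext => z; rewrite mulNmx mul1mx.
  apply: (stable_cvg_mulmx (U := U) (T := fun w => - 1%:M)) => //.
  move=> g e g0 e0; apply: filterS (main g e g0 e0) => n [B [mB PB XB]].
  apply: le_trans PB; apply: le_measure; rewrite ?inE//.
    apply: measurable_set_lt => //; apply: mx_measurable_norm.
    apply: mx_measurableD => //; apply: mx_measurableN.
    by apply: mx_measurableM => //; exact: mx_measurable_cst.
  move=> w /=; rewrite mulNmx mul1mx opprK ltNge => /negP gX.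
  by apply: contrapT => /XB[].
Unshelve. all: by end_near. Qed.
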